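(* Let $X$ and $Y$ be Banach spaces with $\dim X=\infty$ and $\dim Y\ge 1$, and let $(\gamma_j)_{j\ge 1}$ be a sequence of independent standard Gaussian random variables. The following assertions are equivalent: \begin{enumerate} \item[(i)] There is a constant $K$, depending on $X$ and $Y$ only, such that for all finite sequences $x_1,\ldots,x_n\in X$, all scalars $a_1,\dots,a_n>0$, and all $f_1,\dots,f_n\in {\rm Lip}_0(X,Y)$ we have $$\Bigl(\mathbb{E}\Big\|\sum_{j=1}^n \gamma_j a_j^{-1} f_j(a_j x_j)\Big\|^2\Bigr)^{\frac12}\leq K \big(\max_{1\le j\le n}\|f_j\|_{\rm Lip}\big)\Bigl(\mathbb{E}\Big\|\sum_{j=1}^n \gamma_j x_j\Big\|^2\Bigr)^{\frac12}.$$ \item[(ii)] There is a constant $K$, depending on $X$ and $Y$ only, such that for all finite sequences $x_1,\ldots,x_n\in X$ there exist scalars $a_1,\dots,a_n>0$ such that for all $f\in {\rm Lip}_0(X,Y)$ we have $$\Bigl(\mathbb{E}\Big\|\sum_{j=1}^n \gamma_j a_j^{-1} f(a_j x_j)\Big\|^2\Bigr)^{\frac12}\leq K \|f\|_{\rm Lip}\Bigl(\mathbb{E}\Big\|\sum_{j=1}^n \gamma_j x_j\Big\|^2\Bigr)^{\frac12}.$$ \item[(iii)] $X$ has cotype $2$ and $Y$ has type $2$. \end{enumerate} Moreover, if (i) or (ii) holds with constant $K$, then the Gaussian cotype $2$ constant of $X$ and the Gaussian type $2$ constant of $Y$ satisfy $C_2^\gamma(X)\le K$ and $T_2^\gamma(Y)\le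 \sqrt{2}\,K$.
   Context: ${\rm Lip}_0(X,Y)$ denotes the Banach space of all Lipschitz continuous functions $f:X\to Y$ with $f(0)=0$, with norm $\|f\|_{\rm Lip}$ equal to the (best) Lipschitz constant of $f$. Let $(\gamma_j)_{j\ge1}$ be independent standard Gaussian random variables. The Gaussian type $2$ constant $T_2^\gamma(Y)$ is the least constant $T\in[0,\infty]$ such that $(\mathbb{E}\|\sum_{j=1}^n\gamma_j y_j\|^2)^{1/2}\le T(\sum_{j=1}^n\|y_j\|^2)^{1/2}$ for all finite sequences $y_1,\dots,y_n\in Y$. The Gaussian cotype $2$ constant $C_2^\gamma(X)$ is the least constant $C\in[0,\infty]$ such that $(\sum_{j=1}^n\|x_j\|^2)^{1/2}\le C(\mathbb{E}\|\sum_{j=1}^n\gamma_j x_j\|^2)^{1/2}$ for all finite sequences $x_1,\dots,x_n\in X$. A Banach space has type $2$ (resp. cotype $2$) if the corresponding inequality holds with a finite constant; as is well known, it is equivalent to use Rademacher variables instead of Gaussian ones in this definition. *)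

(* Defs.v *)
From HB Require Import structures.
From mathcomp Require Import all_boot all_order all_algebra.
From mathcomp Require Import finmap.
From mathcomp Require Import all_classical all_reals all_analysis.

Set Implicit Arguments.
Unset Strict Implicit.
Unset Printing Implicit Defensive.

Import Order.TTheory GRing.Theory Num.Theory.
Import numFieldNormedType.Exports.

Local Open Scope classical_set_scope.
Local Open Scope ring_scope.

(* A Banach space is a [completeNormedModType R] with [R : realType]. Complex
   Banach spaces are covered by restriction of scalars: dimension being infinite
   (or at least 1), Lip_0, its norm, and norms of random sums with real Gaussian
   coefficients depend only on the underlying real Banach space. *)

Section Dimension.
Context {R : realType}.

Definition lin_indep (V : lmodType R) (n : nat) (e : 'I_n -> V) : Prop :=
  forall c : 'I_n -> R, \sum_(i < n) c i *: e i = 0 -> forall i, c i = 0.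

Definition dim_ge (V : lmodType R) (n : nat) : Prop :=
  exists e : 'I_n -> V, lin_indep e.

Definition infinite_dim (V : lmodType R) : Prop := forall n, dim_ge V n.

End Dimension.

Section Lip0.
Context {R : realType} {X Y : normedModType R}.

Definition Lip0 : set (X -> Y) := [set f | f 0 = 0 /\ lipschitz f].

(* The infimum is only meaningful (nonempty set) when [f] is Lipschitz. The
   constraint [0 <= L] matters only for X = {0}. *)
Definition lipnorm (f : X -> Y) : R := inf [set L | 0 <= L /\ L.-lipschitz f].

End Lip0.

Section Gaussian.
Context d {Omega : measurableType d} {R : realType} {P : probability Omega R}.

(* Independence of the infinite family: the product rule for every finite
   subfamily, against arbitrary Borel sets. *)
Definition mutually_independent (g : nat -> {RV P >-> R}) : Prop :=
  forall (J : {fset nat}) (A : nat -> set R),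
    (forall j, measurable (A j)) ->
    (P (\bigcap_(j in [set` J]) (g j @^-1` A j))
      = \prod_(j <- J) P (g j @^-1` A j))%E.

Definition standard_gaussian (g : {RV P >-> R}) : Prop :=
  forall A : set R, measurable A -> distribution P g A = normal_prob 0 1 A.

Definition standard_gaussian_sequence (g : nat -> {RV P >-> R}) : Prop :=
  (forall j, standard_gaussian (g j)) /\ mutually_independent g.

Variable g : nat -> {RV P >-> R}.

(* (E || sum_j g_j x_j ||^2)^(1/2); indices start at 0. *)
Definition gauss_norm (X : normedModType R) (n : nat) (x : 'I_n -> X) : \bar R :=
  ('E_P[(fun w => `|\sum_(j < n) g j w *: x j| ^+ 2)%R] `^ (2^-1)%R)%E.

Definition l2_norm (X : normedModType R) (n : nat) (x : 'I_n -> X) : R :=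
  Num.sqrt (\sum_(j < n) `|x j| ^+ 2).

(* With [T = +oo] the inequality below always holds, by +oo * 0 = 0 when all
   [y j] vanish; the same remark applies to cotype. *)
Definition type2_with (Y : normedModType R) (T : \bar R) : Prop :=
  forall (n : nat) (y : 'I_n -> Y), (gauss_norm y <= T * (l2_norm y)%:E)%E.

Definition cotype2_with (X : normedModType R) (C : \bar R) : Prop :=
  forall (n : nat) (x : 'I_n -> X), ((l2_norm x)%:E <= C * gauss_norm x)%E.

Definition type2_const (Y : normedModType R) : \bar R :=
  ereal_inf [set T | (0 <= T)%E /\ type2_with Y T].

Definition cotype2_const (X : normedModType R) : \bar R :=
  ereal_inf [set C | (0 <= C)%E /\ cotype2_with X C].

Definition has_type2 (Y : normedModType R) : Prop :=
  exists T : R, 0 <= T /\ type2_with Y T%:E.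

Definition has_cotype2 (X : normedModType R) : Prop :=
  exists C : R, 0 <= C /\ cotype2_with X C%:E.

Definition separate_lip_bound (X Y : normedModType R) (K : R) : Prop :=
  forall (n : nat) (x : 'I_n -> X) (a : 'I_n -> R) (f : 'I_n -> X -> Y),
    (forall j, 0 < a j) -> (forall j, Lip0 (f j)) ->
    (gauss_norm (fun j => (a j)^-1 *: f j (a j *: x j))
      <= (K * \big[Num.max/0]_(j < n) lipnorm (f j))%R%:E * gauss_norm x)%E.

Definition common_lip_bound (X Y : normedModType R) (K : R) : Prop :=
  forall (n : nat) (x : 'I_n -> X),
    exists2 a : 'I_n -> R, (forall j, 0 < a j) &
    forall f : X -> Y, Lip0 f ->
      (gauss_norm (fun j => (a j)^-1 *: f (a j *: x j))
        <= (K * lipnorm f)%R%:E * gauss_norm x)%E.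

End Gaussian.

(* Main.v *)
Require Import Defs.
From HB Require Import structures.
From mathcomp Require Import finmap.
From mathcomp Require Import all_boot all_order all_algebra perm.
From mathcomp Require Import all_classical all_reals all_analysis.
From mathcomp Require Import measurable_realfun.
From mathcomp Require Import ring lra.

Set Implicit Arguments.
Unset Strict Implicit.
Unset Printing Implicit Defensive.

Import Order.TTheory GRing.Theory Num.Theory.
Import numFieldNormedType.Exports.

Local Open Scope classical_set_scope.
Local Open Scope ring_scope.

(** The implication from (iii) to (i) only uses [|a^-1 f (a x)| <= lip f * |x|].

    From (ii), the map [x |-> |x| *: y] with [|y| = 1] gives the cotype 2
    estimate. For type 2, given [y_1, ..., y_n] in [Y], it suffices to find
    almost unit vectors [x_j] in [X] such that
    [|p x_i - q x_j| >= (1 - e) / sqrt 2 * (p + q)] for [p, q >= 0] and [i != j],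
    and such that the Gaussian sum of the vectors [|y_j| x_j] has second moment
    at most [(1 + e) * sum_j |y_j|^2]. Whatever the scalars [a_j] of (ii) are,
    bumps with disjoint supports centered at [a_j |y_j| x_j] add up to a map of
    Lipschitz constant at most [sqrt 2 / (1 - e)] sending [a_j |y_j| x_j] to
    [a_j y_j], and (ii) for this map is the type 2 estimate with constant
    [sqrt 2 * K] up to [e].

    The vectors [x_j] are normalized values of independent copies of
    [Z = sum_k g_k w_k], where [w_1, ..., w_m] are the Dvoretzky-Rogers vectors:
    [|sum_k c_k w_k| <= |c|_2] and [|w_k| >= 1/4]. By cotype 2 the second moment
    of [Z] is at least of order [m], so by concentration [|Z|] is rarely much smaller
    than its root mean square, and by rotation invariance the same holds for
    every normalized combination of the copies. *)

(** * Rotation invariance of Gaussian sequences *)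

(** The scalars [a_j] of (ii) are revealed only after the vectors, so separation must hold for all
    [p] and [q] at once. By homogeneity this is one parameter [th] in [[0, 1]], and a finite grid
    suffices once the norms of the [x_j] are bounded in advance. The constant [sqrt 2] is the
    inverse of the least Euclidean norm of [(th, 1 - th)], attained at [th = 1/2]. The [x_j] depend
    on one random variable and the Gaussian sum on another; integrating over the choice of the [x_j]
    first gives the expected second moment exactly, and a single average selects a sample that meets
    all requirements. Concentration comes from rotations: an independent copy of [Z] is [Z] rotated
    by a right angle, and this angle is halved repeatedly. At a small angle, a functional norming
    [Z] reduces the drop of the norm to a real Gaussian variable of variance at most 1 in any
    dimension. This bounds the drop by a small multiple of the second moment plus a constant, while
    a likely small value of [|Z|] would force a drop comparable to the second moment. Hence the
    second moment must be large under a fixed bound on [sum_k c_k w_k]. *)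

Section Density.
Context d (T : measurableType d) (R : realType) (m : {measure set T -> \bar R}).
Variable p : T -> R.
Hypotheses (mp : measurable_fun setT p) (p0 : forall x, 0 <= p x).

Definition density_measure (A : set T) : \bar R := (\int[m]_(x in A) (p x)%:E)%E.

Let dens0 : density_measure set0 = 0%E.
Proof. by rewrite /density_measure integral_set0. Qed.

Let dens_ge0 A : (0 <= density_measure A)%E.
Proof. by apply: integral_ge0 => x _; rewrite lee_fin. Qed.

Let dens_sigma_additive : semi_sigma_additive density_measure.
Proof.
move=> A mA tA mUA; rewrite /density_measure ge0_integral_bigcup//; last 2 first.
  by apply/measurable_EFinP; exact: measurable_funTS.
  by move=> x _; rewrite lee_fin.
apply: is_cvg_ereal_nneg_natsum_cond => n _ _.
by apply: integral_ge0 => x _; rewrite lee_fin.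
Qed.

HB.instance Definition _ := isMeasure.Build _ _ _
  density_measure dens0 dens_ge0 dens_sigma_additive.

Definition density_as_measure : {measure set T -> \bar R} := density_measure.

Import HBNNSimple.

(** On indicators this is the definition of the measure; simple approximations and monotone
    convergence do the rest. With the normal density it turns the second moment into a Lebesgue
    integral. *)
Lemma ge0_integral_density (f : T -> \bar R) : measurable_fun setT f ->
  (forall x, (0 <= f x)%E) ->
  (\int[density_measure]_x f x = \int[m]_x (f x * (p x)%:E))%E.
Proof.
move=> mf f0.
pose f_ := nnsfun_approx measurableT mf.
transitivity (limn (fun n => \int[density_measure]_x (f_ n x)%:E)%E).
  rewrite -monotone_convergence//.
  - apply: eq_integral => y _; apply/esym/cvg_lim => //.
    by apply: cvg_nnsfun_approx=> // *; apply: f0; rewrite inE.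
  - by move=> n; exact/measurable_EFinP/measurable_funP.
  - by move=> n y _; rewrite lee_fin.
  - by move=> y _ a b ab; rewrite lee_fin; exact/lefP/nd_nnsfun_approx.
transitivity (limn (fun n => \int[m]_x ((f_ n x)%:E * (p x)%:E))%E); last first.
  rewrite -monotone_convergence//; last 3 first.
  - move=> n; apply: emeasurable_funM; last exact/measurable_EFinP.
    exact/measurable_EFinP/measurable_funP.
  - by move=> n y _; rewrite mule_ge0// lee_fin.
  - move=> y _ a b ab; apply: lee_wpmul2r; first by rewrite lee_fin.
    by rewrite lee_fin; exact/lefP/nd_nnsfun_approx.
  apply: eq_integral => y _; apply/cvg_lim => //; apply: cvgeZr => //.
  by apply: cvg_nnsfun_approx=> // *; apply: f0; rewrite inE.
congr (limn _); apply/funext => n.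
transitivity (\sum_(k \in range (f_ n))
    \int[density_measure]_x (k * \1_(f_ n @^-1` [set k]) x)%:E)%E.
  under eq_integral do rewrite fimfunE -fsumEFin//.
  rewrite ge0_integral_fsum//.
  - by move=> y; exact/measurable_EFinP/measurable_funM.
  - by move=> y x _; rewrite nnfun_muleindic_ge0.
transitivity (\sum_(k \in range (f_ n))
    \int[m]_x ((k * \1_(f_ n @^-1` [set k]) x)%:E * (p x)%:E))%E; last first.
  rewrite -ge0_integral_fsum//.
  - apply: eq_integral => y _; rewrite [in RHS]fimfunE -fsumEFin// ge0_mule_fsuml//.
    by move=> r; rewrite nnfun_muleindic_ge0.
  - move=> y; apply: emeasurable_funM; last exact/measurable_EFinP.
    exact/measurable_EFinP/measurable_funM.
  - by move=> y x _; rewrite mule_ge0 ?lee_fin// -lee_fin nnfun_muleindic_ge0.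
apply: eq_fsbigr => r _; rewrite integralZl_indic_nnsfun// integral_indic//=.
rewrite setIT.
have [r0|r0] := ltP r 0.
  rewrite preimage_nnfun0// measure0 mule0 integral0_eq// => x _.
  by rewrite indic0 mulr0 mul0e.
under [RHS]eq_integral do rewrite EFinM -muleA.
rewrite ge0_integralZl//=; last 2 first.
  apply: emeasurable_funM; last exact/measurable_EFinP.
  by apply/measurable_EFinP; exact: measurable_indic.
  by move=> x _; rewrite mule_ge0// lee_fin.
congr (_ * _)%E; rewrite /density_measure integral_mkcond.
apply: eq_integral => x _; rewrite patchE indicE.
by case: ifPn => _; rewrite ?mul1e ?mul0e.
Qed.
End Density.

(** * Plane Lebesgue measure under shears and rotations *)

Section PlaneRotation.
Variable R : realType.
Local Notation mu := (@lebesgue_measure R).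
Local Notation nu := (@normal_prob R 0 1).

Lemma lebesgue_measure_translate (a : R) (A : set R) : measurable A ->
  mu ((fun x => x + a) @^-1` A) = mu A.
Proof.
move=> mA; apply/esym; move: A mA.
pose phi := fun x : measurableTypeR R => x + a : measurableTypeR R.
have mphi : measurable_fun setT phi by exact: measurable_funD.
suff H A : measurable A -> mu A = pushforward mu phi A by exact: H.
move=> mA; apply: lebesgue_measure_unique => //= _ [[b c]] _ <-.
rewrite /pushforward /phi /=.
have -> : (fun x : R => x + a) @^-1` `]b, c] = `]b - a, c - a]%classic.
  by apply/seteqP; split => x /=; rewrite !in_itv/= ltrBlDr lerBrDr.
rewrite !lebesgue_measure_itv/= !lte_fin ltrD2r.
by case: ifP => // _; rewrite -!EFinB opprB addrA subrK.
Qed.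

(** On each line where the second coordinate is constant the shear is a translation, so integrating
    the measures of these sections gives the same value. Uniqueness of the product measure makes
    rectangles enough. *)
Lemma lebesgue_shear (a : R) (C : set (R * R)) : measurable C ->
  (mu \x mu)%E ((fun z => (z.1 + a * z.2, z.2)) @^-1` C) = (mu \x mu)%E C.
Proof.
move=> mC; apply/esym; move: C mC.
pose phi (z : measurableTypeR R * measurableTypeR R) :
  measurableTypeR R * measurableTypeR R := (z.1 + a * z.2, z.2).
have mphi : measurable_fun setT phi.
  apply: measurable_fun_pair => //; apply: measurable_funD => //.
  exact: measurable_funM.
suff H A : measurable A -> (mu \x mu)%E A = pushforward (mu \x mu)%E phi A.
  by move=> C mC; exact: H.
move=> mA; apply: product_measure_unique => // {A mA} A B mA mB.
rewrite /pushforward.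
have mAB : measurable (phi @^-1` (A `*` B)).
  by rewrite -[X in measurable X]setTI; apply: mphi => //; exact: measurableX.
transitivity ((mu \x^ mu)%E (phi @^-1` (A `*` B))).
  by apply: product_measure_unique => // ? ? ? ?; exact: product_measure2E.
rewrite /product_measure2.
rewrite (_ : (fun y => _) = (fun y => (mu A) * (\1_B y)%:E)%E).
  rewrite ge0_integralZl//=; last first.
    by apply/measurable_EFinP; exact: measurable_indic.
  by rewrite integral_indic// setIT.
apply/funext => y /=.
rewrite indicE; case: (boolP (y \in B)) => [/set_mem yB|/negP yB].
  rewrite mule1 -[RHS](lebesgue_measure_translate (a * y))//; congr (mu _).
  by apply/seteqP; split => x; rewrite ysectionE /phi /=; [case|].
rewrite mule0 (_ : ysection _ _ = set0) ?measure0//.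
apply/seteqP; split => x //; rewrite ysectionE /phi /= => -[_ By].
by apply: yB; rewrite inE.
Qed.

Lemma lebesgue_swap (C : set (R * R)) : measurable C ->
  (mu \x mu)%E ((fun z => (z.2, z.1)) @^-1` C) = (mu \x mu)%E C.
Proof.
move=> mC; apply/esym; move: C mC.
pose phi (z : measurableTypeR R * measurableTypeR R) :
  measurableTypeR R * measurableTypeR R := (z.2, z.1).
have mphi : measurable_fun setT phi by exact: measurable_fun_pair.
suff H A : measurable A -> (mu \x mu)%E A = pushforward (mu \x mu)%E phi A.
  by move=> C mC; exact: H.
move=> mA; apply: product_measure_unique => // {A mA} A B mA mB.
transitivity ((mu \x mu)%E (B `*` A)).
  by congr ((mu \x mu)%E _); apply/seteqP; split => -[x y] [].
by rewrite [LHS]product_measure1E// muleC.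
Qed.

Lemma lebesgue_shear2 (a : R) (C : set (R * R)) : measurable C ->
  (mu \x mu)%E ((fun z => (z.1, z.2 + a * z.1)) @^-1` C) = (mu \x mu)%E C.
Proof.
move=> mC.
have mswap : measurable_fun setT (fun z : R * R => (z.2, z.1)).
  exact: measurable_fun_pair.
have msw D : measurable D -> measurable ((fun z : R * R => (z.2, z.1)) @^-1` D).
  by move=> mD; rewrite -[X in measurable X]setTI; exact: mswap.
rewrite -(lebesgue_swap mC) -[RHS](lebesgue_shear a (msw _ mC)) -[RHS]lebesgue_swap.
  by [].
have mphi : measurable_fun setT (fun z : R * R => (z.1 + a * z.2, z.2)).
  by apply: measurable_fun_pair => //; apply: measurable_funD => //;
    exact: measurable_funM.
rewrite -[X in measurable X]setTI; apply: mphi => //; exact: msw.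
Qed.

Definition rotate (c s : R) (z : R * R) : R * R :=
  (c * z.1 - s * z.2, s * z.1 + c * z.2).

Lemma measurable_rotate c s : measurable_fun setT (rotate c s).
Proof.
apply: measurable_fun_pair.
  by apply: measurable_funB; exact: measurable_funM.
by apply: measurable_funD; exact: measurable_funM.
Qed.

Lemma measurable_preimage_rotate c s (C : set (R * R)) : measurable C ->
  measurable (rotate c s @^-1` C).
Proof.
by move=> mC; rewrite -[X in measurable X]setTI; exact: measurable_rotate.
Qed.

(* A rotation is a product of three shears, unless its angle is [pi]. *)
Lemma lebesgue_rotate (c s : R) (C : set (R * R)) : c ^+ 2 + s ^+ 2 = 1 ->
  c != -1 -> measurable C ->
  (mu \x mu)%E (rotate c s @^-1` C) = (mu \x mu)%E C.
Proof.
move=> cs c1 mC.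
have c0 : 1 + c != 0 by rewrite addrC addr_eq0.
(* For the angle with cosine [c] and sine [s], this is minus the tangent of the half angle, infinite
   exactly at [c = -1]. *)
pose a := - s / (1 + c).
have m1 D : measurable D ->
    measurable ((fun z : R * R => (z.1 + a * z.2, z.2)) @^-1` D).
  move=> mD; rewrite -[X in measurable X]setTI; apply: measurable_fun_pair => //.
  by apply: measurable_funD => //; exact: measurable_funM.
have m2 D : measurable D ->
    measurable ((fun z : R * R => (z.1, z.2 + s * z.1)) @^-1` D).
  move=> mD; rewrite -[X in measurable X]setTI; apply: measurable_fun_pair => //.
  by apply: measurable_funD => //; exact: measurable_funM.
pose S1 (z : R * R) := (z.1 + a * z.2, z.2).
pose S2 (z : R * R) := (z.1, z.2 + s * z.1).
suff E : rotate c s @^-1` C = S1 @^-1` (S2 @^-1` (S1 @^-1` C)).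
  rewrite E (lebesgue_shear a (m2 _ (m1 _ mC))) (lebesgue_shear2 s (m1 _ mC)).
  exact: lebesgue_shear.
suff H z : rotate c s z = S1 (S2 (S1 z)).
  by apply/seteqP; split => z /=; rewrite H.
case: z => x y; rewrite /S1 /S2 /rotate /=.
have as1 : a * s = c - 1.
  have s2 : s ^+ 2 = (1 + c) * (1 - c) by rewrite -[LHS](addKr (c ^+ 2)) cs; ring.
  by rewrite /a mulrAC mulNr -expr2 s2 mulNr mulrAC mulfV// mul1r opprB.
have ac : a * (1 + c) = - s by rewrite /a divfK.
have -> : c * x - s * y = x + a * y + a * (y + s * (x + a * y)).
  have -> : x + a * y + a * (y + s * (x + a * y)) =
    x + a * s * x + a * (1 + (1 + a * s)) * y by ring.
  by rewrite as1 (addrC 1 (c - 1)) subrK ac; ring.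
congr pair; have -> : y + s * (x + a * y) = s * x + (1 + a * s) * y by ring.
by rewrite as1 (addrC 1 (c - 1)) subrK.
Qed.

End PlaneRotation.

Lemma ge0_integral_measure_preserving d (T : measurableType d) (R : realType)
    (m : {measure set T -> \bar R}) (phi : T -> T) :
  measurable_fun setT phi ->
  (forall A, measurable A -> m (phi @^-1` A) = m A) ->
  forall (C : set T) (f : T -> \bar R), measurable C -> measurable_fun setT f ->
  (forall x, 0 <= f x)%E ->
  (\int[m]_(x in phi @^-1` C) f (phi x) = \int[m]_(x in C) f x)%E.
Proof.
move=> mphi mE C f mC mf f0.
transitivity (\int[pushforward m phi]_(x in C) f x)%E; last first.
  by apply: eq_measure_integral => A mA _; exact: mE.
by rewrite ge0_integral_pushforward//; exact: measurable_funTS.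
Qed.

(** * The standard normal law on the plane under rotations *)

Section NormalRotation.
Variable R : realType.
Local Notation mu := (@lebesgue_measure R).
Local Notation nu := (@normal_prob R 0 1).

Definition normal_pdf2 (z : R * R) : R := normal_pdf 0 1 z.1 * normal_pdf 0 1 z.2.

Lemma measurable_normal_pdf2 : measurable_fun setT normal_pdf2.
Proof.
apply: measurable_funM.
  by apply: (measurableT_comp (measurable_normal_pdf 0 1)).
by apply: (measurableT_comp (measurable_normal_pdf 0 1)).
Qed.

Lemma normal_pdf2_ge0 z : 0 <= normal_pdf2 z.
Proof. by rewrite mulr_ge0// normal_pdf_ge0. Qed.

Lemma normal_pdf2_rotate c s z : c ^+ 2 + s ^+ 2 = 1 ->
  normal_pdf2 (rotate c s z) = normal_pdf2 z.
Proof.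
case: z => x y cs; rewrite /normal_pdf2 /= !normal_pdfE ?oner_neq0//.
have E : (c * x - s * y) ^+ 2 + (s * x + c * y) ^+ 2 = x ^+ 2 + y ^+ 2.
  by rewrite -[RHS]mul1r -cs; ring.
set p := normal_peak 1; set q := (1 ^+ 2 *+ 2 : R).
have H u v : p * normal_fun 0 1 u * (p * normal_fun 0 1 v) =
    p * p * expR (- (u ^+ 2 + v ^+ 2) / q).
  by rewrite /normal_fun !subr0 mulrACA -expRD -mulrDl -opprD.
by rewrite !H E.
Qed.

Lemma normal_prob2_density (C : set (R * R)) : measurable C ->
  (nu \x nu)%E C = (\int[(mu \x mu)%E]_(z in C) (normal_pdf2 z)%:E)%E.
Proof.
move=> mC.
apply: (@product_measure_unique _ _ _ _ _ nu nu (density_as_measure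
  (mu \x mu)%E measurable_normal_pdf2 normal_pdf2_ge0)) => // A B mA mB.
rewrite /density_as_measure/= /density_measure.
have mpdf : measurable_fun setT (fun x : R => (normal_pdf 0 1 x)%:E).
  by apply/measurable_EFinP; exact: measurable_normal_pdf.
pose h (S : set R) (x : R) : \bar R := ((normal_pdf 0 1 x)%:E * (\1_S x)%:E)%E.
have h0 S x : (0 <= h S x)%E by rewrite mule_ge0// lee_fin ?normal_pdf_ge0.
have mh S : measurable S -> measurable_fun setT (h S).
  move=> mS; apply: emeasurable_funM => //.
  by apply/measurable_EFinP; exact: measurable_indic.
have hE S : measurable S -> (\int[mu]_x h S x = nu S)%E.
  move=> mS; rewrite /normal_prob [RHS]integral_mkcond.
  apply: eq_integral => x _; rewrite patchE /h indicE.
  by case: ifPn => _; rewrite ?mule1 ?mule0.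
transitivity (\int[mu \x mu]_z (h A z.1 * h B z.2))%E.
  rewrite integral_mkcond; apply: eq_integral => -[x y] _.
  rewrite patchE /h /normal_pdf2 !indicE in_setX /=.
  by case: (x \in A); case: (y \in B) => /=; rewrite ?mule1 ?mule0 ?mul0e// EFinM.
rewrite (@fubini_tonelli1 _ _ _ _ _ mu mu (fun z => h A z.1 * h B z.2)%E)/=; last 2 first.
- apply: emeasurable_funM.
    by apply: (measurableT_comp (mh _ mA)).
  by apply: (measurableT_comp (mh _ mB)).
- by move=> z; rewrite mule_ge0.
transitivity (\int[mu]_x (h A x * nu B))%E.
  apply: eq_integral => x _; rewrite /fubini_F -(hE _ mB) /=.
  by rewrite ge0_integralZl//; exact: mh.
by rewrite ge0_integralZr ?hE//; exact: mh.
Qed.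

Lemma normal_prob2_rotate_aux (c s : R) (C : set (R * R)) :
  c ^+ 2 + s ^+ 2 = 1 -> c != -1 -> measurable C ->
  (nu \x nu)%E (rotate c s @^-1` C) = (nu \x nu)%E C.
Proof.
move=> cs c1 mC.
rewrite !normal_prob2_density//; last exact: measurable_preimage_rotate.
transitivity (\int[mu \x mu]_(z in rotate c s @^-1` C)
    (normal_pdf2 (rotate c s z))%:E)%E.
  by apply: eq_integral => z _; rewrite normal_pdf2_rotate.
apply: (@ge0_integral_measure_preserving _ _ _ (mu \x mu)%E (rotate c s) _ _ C
  (fun z => (normal_pdf2 z)%:E)) => //.
- exact: measurable_rotate.
- by move=> A mA; exact: lebesgue_rotate.
- by apply/measurable_EFinP; exact: measurable_normal_pdf2.
- by move=> z; rewrite lee_fin normal_pdf2_ge0.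
Qed.

Lemma normal_prob2_rotate (c s : R) (C : set (R * R)) :
  c ^+ 2 + s ^+ 2 = 1 -> measurable C ->
  (nu \x nu)%E (rotate c s @^-1` C) = (nu \x nu)%E C.
Proof.
move=> cs mC; have [c1|] := eqVneq c (-1); last by move=> ?; exact: normal_prob2_rotate_aux.
(* When [c = -1] the map is the half turn, which is the square of a quarter turn, where the cosine
   is 0. *)
have s0 : s = 0.
  by apply/eqP; rewrite -sqrf_eq0 -[s ^+ 2](addKr (c ^+ 2)) cs c1; apply/eqP; ring.
have q : (0 : R) ^+ 2 + 1 ^+ 2 = 1 by ring.
have q0 : (0 : R) != -1 by rewrite eq_sym oppr_eq0 oner_neq0.
suff E : rotate c s @^-1` C = rotate 0 1 @^-1` (rotate 0 1 @^-1` C).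
  rewrite E !normal_prob2_rotate_aux//; exact: measurable_preimage_rotate.
suff H z : rotate c s z = rotate 0 1 (rotate 0 1 z).
  by apply/seteqP; split => z /=; rewrite H.
by case: z => x y; rewrite c1 s0 /rotate /=; congr pair; ring.
Qed.

End NormalRotation.

Lemma rectangle_measure_unique d1 d2 (T1 : measurableType d1)
    (T2 : measurableType d2) (R : realType)
    (m1 m2 : {measure set (T1 * T2) -> \bar R}) :
  (m1 setT < +oo)%E ->
  (forall A B, measurable A -> measurable B -> m1 (A `*` B) = m2 (A `*` B)) ->
  forall C, measurable C -> m1 C = m2 C.
Proof.
move=> m1oo m12 C mC.
pose G : set (set (T1 * T2)) := [set A `*` B | A in measurable & B in measurable].
apply: (measure_unique G (fun=> setT)) => //.
- by rewrite measurable_prod_measurableType.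
- move=> _ _ [A1 mA1 [B1 mB1 <-]] [A2 mA2 [B2 mB2 <-]].
  rewrite -setXI; exists (A1 `&` A2); first exact: measurableI.
  by exists (B1 `&` B2) => //; exact: measurableI.
- by move=> _; exists setT => //; exists setT => //; rewrite setXTT.
- by rewrite bigcup_const//; exists 0%N.
- by move=> _ [A mA [B mB <-]]; exact: m12.
Qed.

Lemma tuple_measure_unique d (T : measurableType d) (R : realType) n
    (m1 m2 : {measure set (n.-tuple T) -> \bar R}) :
  (m1 setT < +oo)%E ->
  (forall A : 'I_n -> set T, (forall i, measurable (A i)) ->
    m1 [set t | forall i, A i (tnth t i)] = m2 [set t | forall i, A i (tnth t i)]) ->
  forall C, measurable C -> m1 C = m2 C.
Proof.
move=> m1oo m12 C mC.
pose box (A : 'I_n -> set T) : set (n.-tuple T) := [set t | forall i, A i (tnth t i)].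
pose G := [set box A | A in [set A | forall i, measurable (A i)]].
have mbox A : (forall i, measurable (A i)) -> measurable (box A).
  move=> mA; rewrite (_ : box A = \bigcap_(i in setT) ((@tnth n T)^~ i @^-1` A i)); last first.
    by apply/seteqP; split => t /=; [move=> h i _; exact: h|move=> h i; exact: h].
  apply: fin_bigcap_measurable => // i _.
  by rewrite -[X in measurable X]setTI; exact: measurable_tnth.
apply: (measure_unique G (fun=> setT)) => //.
- apply/seteqP; split; last first.
    apply: smallest_sub; first exact: sigma_algebra_measurable.
    by move=> _ [A mA <-]; exact: mbox.
  apply: smallest_sub; first exact: smallest_sigma_algebra.
  move=> X; rewrite -bigcup_seq => -[i _ [Y mY <-]]; apply: sub_sigma_algebra.
  exists (fun j => if j == i then Y else setT); first by move=> j /=; case: ifP.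
  apply/seteqP; split => t /=; first by move=> /(_ i); rewrite eqxx.
  by move=> [_ Yt] j; case: eqP => // ->.
- move=> _ _ [A mA <-] [B mB <-]; exists (fun i => A i `&` B i).
    by move=> i; exact: measurableI.
  apply/seteqP; split => t /=; first by move=> h; split => i; have [] := h i.
  by move=> [h1 h2] i; split.
- by move=> _; exists (fun=> setT) => //; apply/seteqP; split.
- by rewrite bigcup_const//; exists 0%N.
- by move=> _ [A mA <-]; exact: m12.
Qed.

(** * Independent standard Gaussian sequences and single rotations *)

Section GaussianSequence.
Variable R : realType.
Local Notation nu := (@normal_prob R 0 1).

Definition cylinder (T : Type) (g : nat -> T -> R) n (A : nat -> set R) : set T :=
  [set w | forall j, (j < n)%N -> A j (g j w)].

(** Independence and the normal laws are merged in one product formula on initial segments; other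
    finite families arise from [A j = setT], and [n = 0] says that the total mass is 1. Plain
    functions are used so that rotated and juxtaposed sequences are again instances. *)
Definition gaussian_sequence d (T : measurableType d) (P : {measure set T -> \bar R})
    (g : nat -> T -> R) : Prop :=
  (forall j, measurable_fun setT (g j)) /\
  forall n (A : nat -> set R), (forall j, measurable (A j)) ->
    P (cylinder g n A) = (\prod_(j < n) nu (A j))%E.

Section Theory.
Context d (T : measurableType d) (P : {measure set T -> \bar R}).
Implicit Types (g : nat -> T -> R) (A : nat -> set R).

Lemma measurable_cylinder g n A : (forall j, measurable_fun setT (g j)) ->
  (forall j, measurable (A j)) -> measurable (cylinder g n A).
Proof.
move=> mg mA.
rewrite (_ : cylinder g n A = \bigcap_(j in [set j | (j < n)%N]) (g j @^-1` A j)) //.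
apply: bigcap_measurableType => j _.
by rewrite -[X in measurable X]setTI; exact: mg.
Qed.

Lemma gaussian_sequence_setT g : gaussian_sequence P g -> P setT = 1%E.
Proof.
move=> [_ /(_ 0%N (fun=> setT))]; rewrite big_ord0 => <- //.
by congr (P _); apply/seteqP; split.
Qed.

(** A short cylinder is a longer one with [setT] in the added coordinates, each contributing a
    factor 1. Later proofs may thus take [n] beyond all the coordinates they modify. *)
Lemma gaussian_sequence_eventually g n0 : (forall j, measurable_fun setT (g j)) ->
  (forall n A, (n0 <= n)%N -> (forall j, measurable (A j)) ->
    P (cylinder g n A) = (\prod_(j < n) nu (A j))%E) ->
  gaussian_sequence P g.
Proof.
move=> mg H; split => // n A mA.
pose A' j := if (j < n)%N then A j else setT.
pose m := maxn n n0.
have -> : cylinder g n A = cylinder g m A'.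
  apply/seteqP; split => w /= h j; rewrite /A'.
    by case: ifP => // jn _; exact: h.
  by move=> jn; have := h j; rewrite /A' jn leq_max jn; apply.
rewrite H ?leq_maxr//; last by move=> j; rewrite /A'; case: ifP.
rewrite -(big_mkord xpredT (fun j => nu (A' j))) (big_cat_nat _ (leq_maxl n n0))//=.
rewrite [X in (_ * X)%E]big_nat_cond [X in (_ * X)%E]big1 ?mule1; last first.
  move=> j /andP[/andP[nj _] _]; rewrite /A' ltnNge nj /=.
  exact: (@probability_setT _ _ _ nu).
by rewrite big_mkord; apply: eq_bigr => j _; rewrite /A' ltn_ord.
Qed.

Definition rotate_at (a b : nat) (c s : R) g (j : nat) : T -> R :=
  if j == a then (fun w => c * g a w - s * g b w) else
  if j == b then (fun w => s * g a w + c * g b w) else g j.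

(** The conditions on the other coordinates form an event [E] of mass [k]. Restricted to [E], the
    law of [(g a, g b)] is [k] times the plane normal law, since they agree on rectangles; they
    therefore agree on the rotated rectangle, where the plane case applies. *)
Lemma gaussian_sequence_rotate_at a b c s g : a != b -> c ^+ 2 + s ^+ 2 = 1 ->
  gaussian_sequence P g -> gaussian_sequence P (rotate_at a b c s g).
Proof.
move=> ab cs [mg gP].
have mr j : measurable_fun setT (rotate_at a b c s g j).
  rewrite /rotate_at; case: ifP => _; last case: ifP => // _.
    by apply: measurable_funB; exact: measurable_funM.
  by apply: measurable_funD; exact: measurable_funM.
apply: (@gaussian_sequence_eventually _ (maxn a b).+1) => // n A abn mA.
have an : (a < n)%N by apply: leq_trans abn; rewrite ltnS leq_maxl.
have bn : (b < n)%N by apply: leq_trans abn; rewrite ltnS leq_maxr.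
pose upd (U V : set R) j := if j == a then U else if j == b then V else A j.
have mupd U V j : measurable U -> measurable V -> measurable (upd U V j).
  by move=> mU mV; rewrite /upd; case: ifP => // _; case: ifP.
have prodE U V : (\prod_(j < n) nu (upd U V j) = nu U * nu V *
    \prod_(j < n | (j != Ordinal an) && (j != Ordinal bn)) nu (A j))%E.
  rewrite (bigD1 (Ordinal an))//= (bigD1 (Ordinal bn))/=; last first.
    by rewrite -val_eqE/= eq_sym.
  rewrite /upd eqxx eq_sym (negbTE ab) eqxx muleA; congr (_ * _)%E.
  apply: eq_bigr => j /andP[ja jb].
  by rewrite -!val_eqE/= in ja jb; rewrite (negbTE ja) (negbTE jb).
pose E := cylinder g n (upd setT setT).
have mE : measurable E by apply: measurable_cylinder => // j; exact: mupd.
pose phi w : measurableTypeR R * measurableTypeR R := (g a w, g b w).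
have mphi : measurable_fun setT phi by apply: measurable_fun_pair; exact: mg.
have updE U V : cylinder g n (upd U V) = phi @^-1` (U `*` V) `&` E.
  apply/seteqP; split => w /=.
    move=> h; split; first split.
    - by have := h a an; rewrite /upd eqxx.
    - by have := h b bn; rewrite /upd eqxx eq_sym (negbTE ab).
    - move=> j jn; have := h j jn; rewrite /upd; case: ifP => // _; by case: ifP.
  move=> [[/= Ua Vb] h] j jn; have := h j jn; rewrite /upd.
  by case: eqP => [->//|_]; case: eqP => [->//|_].
set k := (\prod_(j < n | (j != Ordinal an) && (j != Ordinal bn)) nu (A j))%E in prodE.
have kE : P E = k.
  rewrite gP; last by move=> j; exact: mupd.
  by rewrite prodE (@probability_setT _ _ _ nu) !mul1e.
have Poo : (P E < +oo)%E.
  apply: (@le_lt_trans _ _ (P setT)); first by apply: le_measure; rewrite ?inE.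
  by rewrite (gaussian_sequence_setT (conj mg gP)) ltry.
have k0 : 0 <= fine k by rewrite -kE fine_ge0.
have kfin : (fine k)%:E = k by rewrite fineK// -kE ge0_fin_numE.
have key B : measurable B -> P (phi @^-1` B `&` E) = (k * (nu \x nu) B)%E.
  move=> mB.
  suff : mscale (NngNum k0) (nu \x nu)%E B = pushforward (mrestr P mE) phi B.
    by rewrite /mscale /= kfin => ->.
  apply: rectangle_measure_unique => // [|U V mU mV].
    rewrite /= /mscale /= kfin -kE -setXTT product_measure1E//.
    by rewrite /= (@probability_setT _ _ _ nu) !mule1.
  rewrite /= /mscale /= kfin product_measure1E//.
  rewrite /pushforward /mrestr /= -updE gP; last by move=> j; exact: mupd.
  by rewrite prodE muleC.
have rotE : cylinder (rotate_at a b c s g) n A =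
    phi @^-1` (rotate c s @^-1` (A a `*` A b)) `&` E.
  apply/seteqP; split => w /=.
    move=> h; split; first split.
    - by have := h a an; rewrite /rotate_at eqxx.
    - by have := h b bn; rewrite /rotate_at eqxx eq_sym (negbTE ab).
    - move=> j jn; have := h j jn; rewrite /rotate_at /upd.
      by case: ifP => // ja; case: ifP.
  move=> [[/= Ua Vb] h] j jn; have := h j jn; rewrite /rotate_at /upd.
  by case: eqP => [->//|_]; case: eqP => [->//|_].
have mAB : measurable (A a `*` A b) by exact: measurableX.
rewrite rotE key; last exact: measurable_preimage_rotate.
rewrite normal_prob2_rotate// product_measure1E; [|exact: mA|exact: mA].
rewrite muleC -prodE; apply: eq_bigr => j _; rewrite /upd.
by case: eqP => [->//|_]; case: eqP => [->//|_].
Qed.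

End Theory.
End GaussianSequence.

(** * Measurability of norms of random sums *)

Section MeasurableNorm.
Variables (R : realType) (X : normedModType R).

Lemma norm_lincomb_sub N (v : 'I_N -> X) (a b : 'I_N -> R) :
  `|\sum_(k < N) a k *: v k| <= `|\sum_(k < N) b k *: v k| + \sum_(k < N) `|a k - b k| * `|v k|.
Proof.
have -> : \sum_(k < N) a k *: v k =
    \sum_(k < N) b k *: v k + \sum_(k < N) (a k - b k) *: v k.
  by rewrite -big_split; apply: eq_bigr => k _ /=; rewrite -scalerDl addrC subrK.
apply: (le_trans (ler_normD _ _)); rewrite lerD2l.
apply: (le_trans (ler_norm_sum _ _ _)); apply: ler_sum => k _.
by rewrite normrZ.
Qed.

(* The addition of a nonseparable normed space need not be measurable, so the
   norm is written as a countable infimum over rational coefficients. *)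
Lemma measurable_norm_lincomb d (T : measurableType d) N (v : 'I_N -> X)
    (h : 'I_N -> T -> R) : (forall k, measurable_fun setT (h k)) ->
  measurable_fun setT (fun w => `|\sum_(k < N) h k w *: v k|).
Proof.
move=> mh.
pose e (m : nat) : {ffun 'I_N -> rat} := odflt [ffun=> 0] (unpickle m).
pose F (m : nat) (w : T) : R := `|\sum_(k < N) ratr (e m k) *: v k| +
  \sum_(k < N) `|h k w - ratr (e m k)| * `|v k|.
have lbF w m : `|\sum_(k < N) h k w *: v k| <= F m w by exact: norm_lincomb_sub.
rewrite (_ : (fun w => _) = (fun w => infs (F ^~ w) 0)).
  apply: measurable_fun_infs.
    by move=> w _; exists `|\sum_(k < N) h k w *: v k| => _ [m _ <-].
  move=> m; apply: measurable_funD => //; apply: measurable_sum => k.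
  apply: measurable_funM => //; apply: measurableT_comp => //.
  exact: measurable_funB.
apply/funext => w; apply/eqP; rewrite eq_le; apply/andP; split.
  apply: lb_le_inf; first by exists (F 0%N w); exists 0%N.
  by move=> _ [m _ <-].
apply/ler_addgt0Pr => r r0.
(* The error [r / K] of each rational coefficient is counted twice, once in the correction term of
   [F] and once when the two norms are compared; the 1 keeps [K] positive. *)
pose K := 1 + \sum_(k < N) 2 * `|v k|.
have K0 : 0 < K by rewrite ltr_pwDl// sumr_ge0// => k _; rewrite mulr_ge0.
have rK : 0 < r / K by rewrite divr_gt0.
have /choice[q hq] k : exists q : rat, `|h k w - ratr q| <= r / K.
  have [|q] := @rat_in_itvoo R (h k w - r / K) (h k w + r / K).
    by rewrite ltrD2l (lt_trans _ rK)// oppr_lt0.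
  by rewrite in_itv/= => /andP[q1 q2]; exists q; rewrite ler_norml; lra.
have /= em : e (pickle [ffun k => q k]) = [ffun k => q k] by rewrite /e pickleK.
apply: (@le_trans _ _ (F (pickle [ffun k => q k]) w)).
  apply: ge_inf; last by exists (pickle [ffun k => q k]).
  by exists `|\sum_(k < N) h k w *: v k| => _ [m _ <-].
apply: (@le_trans _ _ (`|\sum_(k < N) h k w *: v k| + \sum_(k < N) `|ratr (q k) - h k w| * `|v k|
   + \sum_(k < N) `|h k w - ratr (q k)| * `|v k|)).
  rewrite /F em; under eq_bigr do rewrite ffunE.
  under [X in _ + X]eq_bigr do rewrite ffunE.
  by rewrite lerD2r norm_lincomb_sub.
rewrite -addrA lerD2l -big_split /=.
apply: (@le_trans _ _ (r / K * \sum_(k < N) 2 * `|v k|)).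
  rewrite mulr_sumr; apply: ler_sum => k _; rewrite (distrC (ratr _)).
  have := hq k; have := normr_ge0 (v k); nra.
rewrite -mulrA ler_piMr ?(ltW r0)//.
by rewrite ler_pdivrMl// mulr1 /K lerDr.
Qed.

End MeasurableNorm.

Section GaussianTheory.
Variable R : realType.
Local Notation nu := (@normal_prob R 0 1).

Definition gtuple (T : Type) (g : nat -> T -> R) n (w : T) : n.-tuple R :=
  [tuple g i w | i < n].

Lemma measurable_gtuple d (T : measurableType d) (g : nat -> T -> R) n :
  (forall j, measurable_fun setT (g j)) -> measurable_fun setT (gtuple g n).
Proof.
move=> mg; apply/measurable_fun_tnthP => i.
by rewrite (_ : _ \o _ = g i)//; apply/funext => w /=; rewrite tnth_mktuple.
Qed.

Lemma gaussian_law_unique d1 (T1 : measurableType d1) (P1 : {measure set T1 -> \bar R})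
    d2 (T2 : measurableType d2) (P2 : {measure set T2 -> \bar R})
    (g1 : nat -> T1 -> R) (g2 : nat -> T2 -> R) n (h : n.-tuple R -> \bar R) :
  gaussian_sequence P1 g1 -> gaussian_sequence P2 g2 ->
  measurable_fun setT h -> (forall t, 0 <= h t)%E ->
  (\int[P1]_w h (gtuple g1 n w) = \int[P2]_w h (gtuple g2 n w))%E.
Proof.
move=> G1 G2 mh h0.
have m1 := @measurable_gtuple _ _ g1 n G1.1.
have m2 := @measurable_gtuple _ _ g2 n G2.1.
transitivity (\int[pushforward P1 (gtuple g1 n)]_t h t)%E.
  by rewrite [RHS]ge0_integral_pushforward ?preimage_setT// => t _; exact: h0.
transitivity (\int[pushforward P2 (gtuple g2 n)]_t h t)%E; last first.
  by rewrite [LHS]ge0_integral_pushforward ?preimage_setT// => t _; exact: h0.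
apply: eq_measure_integral => A mA _; apply: tuple_measure_unique => //.
  by rewrite /= /pushforward preimage_setT (gaussian_sequence_setT G1) ltry.
move=> B mB; rewrite /= /pushforward.
pose B' (j : nat) : set R := if insub j is Some i then B i else setT.
have mB' j : measurable (B' j) by rewrite /B'; case: insub.
have E (T : Type) (g : nat -> T -> R) :
    gtuple g n @^-1` [set t | forall i, B i (tnth t i)] = cylinder g n B'.
  apply/seteqP; split => w /= H.
    move=> j jn; have := H (Ordinal jn); rewrite tnth_mktuple /B'.
    by rewrite insubT.
  by move=> i; have := H i (ltn_ord i); rewrite tnth_mktuple /B' valK.
by rewrite !E G1.2// G2.2.
Qed.

End GaussianTheory.

Section GaussianConstructions.
Variable R : realType.
Local Notation nu := (@normal_prob R 0 1).

Lemma standard_gaussian_sequenceP d (T : measurableType d) (P : probability T R)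
    (g : nat -> {RV P >-> R}) :
  standard_gaussian_sequence g -> gaussian_sequence P (fun j => g j).
Proof.
move=> [gN gI]; split; first by move=> j; exact: measurable_funPT.
move=> n A mA; pose J : {fset nat} := seq_fset tt (iota 0 n).
have JE j : (j \in J) = (j < n)%N by rewrite seq_fsetE mem_iota.
rewrite (_ : cylinder _ n A = \bigcap_(j in [set` J]) (g j @^-1` A j)); last first.
  apply/seteqP; split => w /= h j.
    by rewrite /= JE; exact: h.
  by move=> jn; have := h j; rewrite /= JE; exact.
apply: (etrans (gI J A mA)); rewrite (perm_big (index_iota 0 n)) /=; last first.
  apply: uniq_perm; [exact: (fset_uniq J)|exact: iota_uniq|move=> j].
  by rewrite JE mem_index_iota.
rewrite big_mkord; apply: eq_bigr => j _.
exact: gN.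
Qed.

Section ProductSpace.
Context d (T : measurableType d) (P : probability T R) (g : nat -> T -> R).
Hypothesis gP : gaussian_sequence P g.

(** The first [N] coordinates and the later ones become functions of separate variables, so that
    Fubini's theorem can integrate one Gaussian vector while an independent copy stays fixed. *)
Definition juxtapose N (j : nat) : T * T -> R :=
  if (j < N)%N then (fun z => g j z.1) else (fun z => g (j - N)%N z.2).

Lemma gaussian_sequence_juxtapose N :
  gaussian_sequence (P \x P)%E (juxtapose N).
Proof.
have mg j : measurable_fun setT (juxtapose N j).
  rewrite /juxtapose; case: ifP => _.
    exact: (measurableT_comp (gP.1 j)).
  exact: (measurableT_comp (gP.1 (j - N)%N)).
apply: (@gaussian_sequence_eventually _ _ _ _ _ N) => // n A Nn mA.
have -> : cylinder (juxtapose N) n A =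
    cylinder g N A `*` cylinder g (n - N) (fun j => A (N + j)%N).
  apply/seteqP; split => -[w1 w2] /=.
    move=> h; split => j jN.
      by have := h j (leq_trans jN Nn); rewrite /juxtapose jN.
    have := h (N + j)%N.
    rewrite (_ : juxtapose N (N + j) = fun z => g j z.2); last first.
      by rewrite /juxtapose ltnNge leq_addr /= addKn.
    by apply; rewrite -ltn_subRL.
  move=> [h1 h2] j jn; rewrite /juxtapose; case: ltnP => jN; first exact: h1.
  have := h2 (j - N)%N; rewrite /= subnKC//; apply.
  by rewrite ltn_sub2r// (leq_ltn_trans jN).
rewrite [LHS]product_measure1E; last 2 first.
  by apply: measurable_cylinder => //; exact: gP.1.
  by apply: measurable_cylinder => //; exact: gP.1.
rewrite !gP.2//.
rewrite -[RHS](big_mkord xpredT (fun j => nu (A j))) (big_cat_nat _ Nn)//= big_mkord.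
congr (_ * _)%E; rewrite -[X in index_iota X](add0n N) big_addn big_mkord.
by apply: eq_bigr => j _; rewrite addnC.
Qed.

End ProductSpace.

Section BlockRotation.
Context d (T : measurableType d) (P : {measure set T -> \bar R}).
Implicit Types g : nat -> T -> R.

Definition rotate_block (a b N : nat) (c s : R) g (j : nat) : T -> R :=
  if (a <= j < a + N)%N then (fun w => c * g j w - s * g (b + (j - a))%N w) else
  if (b <= j < b + N)%N then (fun w => s * g (a + (j - b))%N w + c * g j w) else g j.

(** The block rotation is a composition of single rotations, one for each pair [(a + i, b + i)].
    Since [a + N <= b] the blocks are disjoint, and each new rotation meets coordinates that the
    earlier ones left unchanged. *)
Lemma gaussian_sequence_rotate_block a b N c s g : (a + N <= b)%N ->
  c ^+ 2 + s ^+ 2 = 1 ->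
  gaussian_sequence P g -> gaussian_sequence P (rotate_block a b N c s g).
Proof.
move=> + cs gP; elim: N => [|N IH] ab.
  rewrite (_ : rotate_block _ _ _ _ _ _ = g)//; apply/funext => j.
  by rewrite /rotate_block !addn0 !ltnNge !andbN.
rewrite addnS in ab.
rewrite (_ : rotate_block _ _ _ _ _ _ =
   rotate_at (a + N)%N (b + N)%N c s (rotate_block a b N c s g)).
  apply: gaussian_sequence_rotate_at => //; last exact: IH (ltnW ab).
  by rewrite eqn_add2r neq_ltn (leq_ltn_trans (leq_addr N a) ab).
apply/funext => j; rewrite /rotate_at.
have Ea : rotate_block a b N c s g (a + N) = g (a + N)%N.
  by rewrite /rotate_block ltnn andbF (leqNgt b) ab.
have Eb : rotate_block a b N c s g (b + N) = g (b + N)%N.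
  rewrite /rotate_block ltnn andbF (ltnNge _ (a + N)) (leq_trans (ltnW ab))//.
    by rewrite andbF.
  exact: leq_addr.
rewrite Ea Eb; case: eqP => [->|/eqP ja].
  by rewrite /rotate_block leq_addr addnS ltnSn /= addKn.
case: eqP => [->|/eqP jb].
  rewrite /rotate_block leq_addr (addnS b) ltnSn /=.
  by rewrite (ltnNge _ (a + _)) addnS (leq_trans ab (leq_addr _ _)) andbF addKn.
by rewrite /rotate_block !addnS !ltnS !(leq_eqVlt j) (negbTE ja) (negbTE jb).
Qed.

End BlockRotation.
End GaussianConstructions.

(** * Random vectors with Gaussian coefficients *)

Section GaussianVectors.
Variables (R : realType) (X : normedModType R) (N : nat) (v : 'I_N -> X).

(** The offset [a] produces independent copies from a single sequence: the blocks starting at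
    [i * N] are disjoint. *)
Definition gaussian_vector (T : Type) (g : nat -> T -> R) (a : nat) (w : T) : X :=
  \sum_(k < N) g (a + k)%N w *: v k.

Lemma measurable_norm_tuple_lincomb :
  measurable_fun setT (fun t : N.-tuple R => `|\sum_(k < N) tnth t k *: v k|).
Proof. by apply: measurable_norm_lincomb => k; exact: measurable_tnth. Qed.

Lemma gaussian_vector_law_unique d1 (T1 : measurableType d1)
    (P1 : {measure set T1 -> \bar R}) d2 (T2 : measurableType d2)
    (P2 : {measure set T2 -> \bar R}) (g1 : nat -> T1 -> R) (g2 : nat -> T2 -> R)
    (F : R -> \bar R) :
  gaussian_sequence P1 g1 -> gaussian_sequence P2 g2 ->
  measurable_fun setT F -> (forall r, 0 <= F r)%E ->
  (\int[P1]_w F (`|gaussian_vector g1 0 w|)%R = \int[P2]_w F (`|gaussian_vector g2 0 w|)%R)%E.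
Proof.
move=> G1 G2 mF F0.
pose h (t : N.-tuple R) := F (`|\sum_(k < N) tnth t k *: v k|)%R.
have E (T : Type) (g : nat -> T -> R) w : F (`|gaussian_vector g 0 w|)%R = h (gtuple g N w).
  by congr (F _); congr (`|_|); apply: eq_bigr => k _; rewrite add0n tnth_mktuple.
under eq_integral do rewrite E; under [RHS]eq_integral do rewrite E.
apply: gaussian_law_unique => //; last by move=> t; exact: F0.
apply: (measurableT_comp mF); exact: measurable_norm_tuple_lincomb.
Qed.

(* The combination of the last two independent copies is replaced by a single
   copy, by rotating the corresponding blocks of coordinates. *)
Lemma gaussian_vector_stable d (T : measurableType d) (P : {measure set T -> \bar R})
    (F : R -> \bar R) (n : nat) (c : nat -> R) (g : nat -> T -> R) :
  measurable_fun setT F -> (forall r, 0 <= F r)%E -> gaussian_sequence P g ->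
  (\int[P]_w F (`|\sum_(i < n.+1) c i *: gaussian_vector g (i * N) w|)%R =
   \int[P]_w F (Num.sqrt (\sum_(i < n.+1) c i ^+ 2) * `|gaussian_vector g 0 w|)%R)%E.
Proof.
move=> mF F0; elim: n c g => [|n IH] c g gP.
  by apply: eq_integral => w _; rewrite !big_ord1 mul0n normrZ sqrtr_sqr.
pose r := Num.sqrt (c n ^+ 2 + c n.+1 ^+ 2).
have r2 : r ^+ 2 = c n ^+ 2 + c n.+1 ^+ 2 by rewrite sqr_sqrtr// addr_ge0// sqr_ge0.
(* The minus sign matches the first output [C * x - S * y] of [rotate_block]. When [r = 0] both
   coefficients vanish and the identity rotation serves. *)
have [C [S [CS rC rS]]] : exists C S, [/\ C ^+ 2 + S ^+ 2 = 1, r * C = c n & r * S = - c n.+1].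
  have [r0|r0] := eqVneq r 0.
    exists 1, 0; rewrite r0 !mul0r; move: r2; rewrite r0 expr0n/= => /esym/eqP.
    rewrite paddr_eq0 ?sqr_ge0// !sqrf_eq0 => /andP[/eqP-> /eqP->].
    by split; [ring| |rewrite oppr0].
  exists (c n / r), (- c n.+1 / r); rewrite !mulrA !(mulrC r) !mulfK//; split => //.
  by rewrite !expr_div_n sqrrN -mulrDl -r2 mulfV// expf_eq0.
pose g' := rotate_block (n * N) (n.+1 * N) N C S g.
pose c' i := if i == n then r else c i.
have g'P : gaussian_sequence P g'.
  by apply: gaussian_sequence_rotate_block => //; rewrite mulSn addnC.
have Zlt w i : (i < n)%N -> gaussian_vector g' (i * N) w = gaussian_vector g (i * N) w.
  move=> i_n; apply: eq_bigr => k _; congr (_ *: _).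
  have H : (i * N + k < n * N)%N.
    have := leq_mul i_n (leqnn N); rewrite mulSn; apply: leq_trans.
    by rewrite addnC ltn_add2r.
  by rewrite /g' /rotate_block leqNgt H/= leqNgt (leq_trans H)// leq_mul2r leqnSn orbT.
have Zn w : gaussian_vector g' (n * N) w =
    C *: gaussian_vector g (n * N) w - S *: gaussian_vector g (n.+1 * N) w.
  rewrite /gaussian_vector !scaler_sumr -sumrB; apply: eq_bigr => k _.
  by rewrite /g' /rotate_block leq_addr ltn_add2l ltn_ord/= addKn scalerBl !scalerA.
transitivity (\int[P]_w F (`|\sum_(i < n.+1) c' i *: gaussian_vector g' (i * N) w|)%R)%E.
  apply: eq_integral => w _; congr (F _); congr (`|_|).
  rewrite big_ord_recr big_ord_recr [RHS]big_ord_recr /= -addrA; congr (_ + _).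
    by apply: eq_bigr => i _; rewrite Zlt// /c' ltn_eqF.
  by rewrite /c' eqxx Zn scalerBr !scalerA rC rS scaleNr opprK.
have c'2 : \sum_(i < n.+1) c' i ^+ 2 = \sum_(i < n.+2) c i ^+ 2.
  rewrite big_ord_recr [RHS]big_ord_recr [X in _ = X + _]big_ord_recr /= -addrA.
  rewrite /c' eqxx r2; congr (_ + _).
  by apply: eq_bigr => i _; rewrite ltn_eqF.
rewrite (IH _ _ g'P) c'2.
apply: (gaussian_vector_law_unique (F := fun r => F (Num.sqrt (\sum_(i < n.+2) c i ^+ 2) * r))) => //.
by apply: (measurableT_comp mF); exact: measurable_funM.
Qed.

End GaussianVectors.

(** * Second moments *)

Section NormalVariance.
Variable R : realType.
Local Notation mu := (@lebesgue_measure R).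
Local Notation nu := (@normal_prob R 0 1).
Let p : R -> R := normal_pdf 0 1.

Let pE x : p x = normal_peak 1 * expR (- (2^-1 * x ^+ 2)).
Proof.
rewrite /p normal_pdfE ?oner_neq0// /normal_fun; congr (_ * expR _).
by rewrite subr0 expr1n mulNr mulrC.
Qed.

Let pN x : p (- x) = p x. Proof. by rewrite !pE sqrrN. Qed.

Let p_ge0 x : 0 <= p x. Proof. exact: normal_pdf_ge0. Qed.

Let cont_p : continuous p.
Proof. by apply: continuous_normal_pdf; exact: oner_neq0. Qed.

Let is_derive_p (x : R) : is_derive x 1 (fun t => - p t) (x * p x).
Proof.
rewrite (_ : (fun t => - p t) =
  (- normal_peak 1) *: (fun t : R => expR (- (2^-1 * t ^+ 2)))); last first.
  by apply/funext => t /=; rewrite pE -mulNr.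
apply: is_derive_eq; rewrite pE /GRing.scale /=.
by field.
Qed.

Let p_cvgy : p x @[x --> +oo] --> (0 : R).
Proof.
apply: (@squeeze_cvgr _ _ _ _ (fun=> 0) (fun x => normal_peak 1 * expR (- x))).
- near=> x; rewrite p_ge0 pE ler_wpM2l ?normal_peak_ge0// ler_expR lerN2.
  have : 2 <= x by near: x; apply: nbhs_pinfty_ge; exact: num_real.
  nra.
- exact: cvg_cst.
- by rewrite -(mulr0 (normal_peak 1)); apply: cvgMr; exact: cvgr_expR.
Unshelve. all: end_near. Qed.

Let integral_tail (x : R) : 0 <= x ->
  (\int[mu]_(t in `[x, +oo[) (t * p t)%:E = (p x)%:E)%E.
Proof.
move=> x0; rewrite (@ge0_continuous_FTC2y _ (fun t => t * p t) (fun t => - p t) x 0).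
- by rewrite EFinN oppeK add0e.
- by move=> t xt; rewrite mulr_ge0// (le_trans x0).
- apply: continuous_subspaceT => t; apply: cvgM; [exact: cvg_id|exact: cont_p].
- by rewrite -oppr0; apply: cvgN.
- by move=> t _; have [] := is_derive_p t.
- by apply: cvg_at_right_filter; apply: cvgN; exact: cont_p.
- by move=> t _; rewrite derive1E; have [] := is_derive_p t.
Qed.

(* Tonelli's theorem, after writing [t ^+ 2 * p t] as the integral of [t * p t]
   over [x <= t]. *)
Let half_second_moment : (\int[mu]_(t in [set t | 0 <= t]%R) (t ^+ 2 * p t)%:E =
  \int[mu]_(t in [set t | 0 <= t]%R) (p t)%:E)%E.
Proof.
pose D := [set z : R * R | 0 <= z.1 <= z.2].
pose f (z : R * R) : \bar R := ((z.2 * p z.2) * \1_D z)%:E.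
have mp : measurable_fun setT p by exact: measurable_normal_pdf.
have mD : measurable D.
  rewrite (_ : D = (setT `&` [set z | cst 0 z <= z.1]) `&`
    (setT `&` [set z | z.1 <= z.2])); last first.
    by rewrite !setTI; apply/seteqP; split => z /=; [move=> /andP[]|move=> [? ?]; apply/andP].
  by apply: measurableI; apply: measurable_fun_le.
have mf : measurable_fun setT f.
  apply/measurable_EFinP; apply: measurable_funM; last exact: measurable_indic.
  by apply: measurable_funM => //; apply: (measurableT_comp mp).
have f0 z : (0 <= f z)%E.
  rewrite lee_fin indicE; case: (boolP (z \in D)) => [|_]; last by rewrite mulr0.
  by move=> /set_mem/andP[z1 z2]; rewrite mulr1 mulr_ge0// (le_trans z1).
transitivity (\int[mu]_t \int[mu]_x f (x, t))%E.
  rewrite integral_mkcond; apply: eq_integral => t _; rewrite patchE.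
  case: ifPn => [/set_mem /= t0|/negP nt0].
    under eq_integral do rewrite /f /= EFinM.
    have mI : measurable_fun setT (fun x => (\1_D (x, t))%:E : \bar R).
      apply/measurable_EFinP.
      rewrite (_ : (fun x => _) = \1_(`[0, t]%classic)); last first.
        by apply/funext => x; rewrite !indicE; congr ((nat_of_bool _)%:R).
      by apply: measurable_indic; exact: measurable_itv.
    rewrite ge0_integralZl//; last by rewrite lee_fin mulr_ge0.
    have -> : (\int[mu]_x (\1_D (x, t))%:E = t%:E)%E.
      transitivity (\int[mu]_x (\1_(`[0, t]%classic) x)%:E)%E.
        by apply: eq_integral => x _; rewrite !indicE; congr ((nat_of_bool _)%:R%:E).
      rewrite integral_indic//= setIT lebesgue_measure_itv/= lte_fin.
      by case: ltP => [_|t0']; [rewrite oppr0 adde0|congr _%:E; apply/eqP; rewrite eq_le t0].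
    by rewrite -EFinM; congr _%:E; ring.
  rewrite integral0_eq// => x _; rewrite /f indicE memNset ?mulr0//= => /andP[x0 xt].
  by apply: nt0; rewrite inE /= (le_trans x0).
rewrite -fubini_tonelli//.
rewrite [RHS]integral_mkcond; apply: eq_integral => x _; rewrite patchE.
case: ifPn => [/set_mem /= x0|/negP nx0].
  rewrite -integral_tail// [RHS]integral_mkcond; apply: eq_integral => t _.
  rewrite patchE /f indicE /=; case: ifPn => [|nt].
    rewrite inE /= in_itv /= andbT => xt.
    have -> : (x, t) \in D by rewrite inE /D /= x0.
    by rewrite mulr1.
  rewrite memNset ?mulr0//= => /andP[_ xt]; move/negP: nt; apply.
  by rewrite inE /= in_itv /= xt.
rewrite integral0_eq// => t _; rewrite /f indicE memNset ?mulr0//= => /andP[x0 _].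
by apply: nx0; rewrite inE.
Qed.

Lemma normal_second_moment : (\int[nu]_x (x ^+ 2)%:E = 1)%E.
Proof.
have mp : measurable_fun setT p by exact: measurable_normal_pdf.
transitivity (\int[density_measure mu p]_x (x ^+ 2)%:E)%E; first by [].
rewrite ge0_integral_density//; last 2 first.
  by apply/measurable_EFinP; exact: measurable_funX.
  by move=> x; rewrite lee_fin sqr_ge0.
under eq_integral do rewrite -EFinM.
rewrite (@ge0_symfun_integralT _ (fun x => x ^+ 2 * p x)); last 3 first.
- by move=> x; rewrite mulr_ge0// sqr_ge0.
- by move=> x; apply: cvgM; [exact: exprn_continuous|exact: cont_p].
- by move=> x /=; rewrite sqrrN pN.
rewrite half_second_moment -ge0_symfun_integralT//; last by move=> x /=; rewrite pN.
exact: integral_normal_pdf.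
Qed.

End NormalVariance.

Section SecondMoment.
Variable R : realType.

Lemma gaussian_second_moment d (T : measurableType d) (P : {measure set T -> \bar R})
    (g : nat -> T -> R) n (c : nat -> R) : gaussian_sequence P g ->
  (\int[P]_w ((\sum_(i < n) c i * g i w) ^+ 2)%:E = (\sum_(i < n) c i ^+ 2)%:E)%E.
Proof.
move=> gP; case: n => [|n].
  by rewrite integral0_eq ?big_ord0// => w _; rewrite big_ord0 expr0n.
(* In the line, with the single vector 1, each [g i] is a Gaussian vector; stability then takes the
   place of expanding the square and computing the cross terms. *)
pose v (k : 'I_1) : R^o := 1.
have vE i w : gaussian_vector v g (i * 1) w = g i w.
  by rewrite /gaussian_vector big_ord1 addn0 muln1 /GRing.scale /= mulr1.
transitivity (\int[P]_w (fun r : R => (r ^+ 2)%:E)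
    (`|\sum_(i < n.+1) c i *: gaussian_vector v g (i * 1) w|)%R)%E.
  apply: eq_integral => w _ /=; rewrite real_normK ?num_real//.
  by congr ((_ ^+ 2)%:E); apply: eq_bigr => i _; rewrite vE.
have m2 : measurable_fun setT (fun r : R => (r ^+ 2)%:E).
  by apply/measurable_EFinP; exact: measurable_funX.
have p2 (r : R) : (0 <= (r ^+ 2)%:E)%E by rewrite lee_fin sqr_ge0.
rewrite (gaussian_vector_stable v n c m2 p2 gP).
set S := \sum_(i < n.+1) c i ^+ 2.
have S0 : 0 <= S by apply: sumr_ge0 => i _; exact: sqr_ge0.
transitivity (S%:E * \int[P]_w (g 0%N w ^+ 2)%:E)%E.
  rewrite -ge0_integralZl//; last first.
    by apply/measurable_EFinP; apply: measurable_funX; exact: gP.1.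
  apply: eq_integral => w _; rewrite -EFinM; congr _%:E.
  rewrite exprMn sqr_sqrtr//; congr (_ * _).
  by rewrite real_normK ?num_real// -(vE 0%N w).
rewrite -[RHS]mule1 -normal_second_moment; congr (_ * _)%E.
pose g0 : T -> measurableTypeR R := g 0%N.
have mg0 : measurable_fun setT g0 by exact: gP.1.
transitivity (\int[pushforward P g0]_x (x ^+ 2)%:E)%E.
  by rewrite [RHS]ge0_integral_pushforward ?preimage_setT.
apply: eq_measure_integral => A mA _.
have := gP.2 1%N (fun=> A) (fun=> mA); rewrite big_ord1 => H; apply: etrans H.
congr (P _); apply/seteqP; split => w /=; last by move=> /(_ 0%N); exact.
by move=> H [].
Qed.

End SecondMoment.

(** * Norming functionals on finitely many vectors *)

Section FiniteHahnBanach.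
Variables (R : realType) (V : lmodType R).
Implicit Types (p : V -> R) (u x y : V).

Definition sublinear p : Prop :=
  [/\ p 0 = 0, (forall x y, p (x + y) <= p x + p y) &
      forall (c : R) x, 0 < c -> p (c *: x) <= c * p x].

(* The one-dimensional step of the Hahn-Banach theorem: the reduced functional
   lies below [p], is odd at [u] and keeps the vectors at which [p] is odd. *)
Definition sublinear_reduce p u x : R :=
  inf [set p (x + t *: u) - t * p u | t in [set t : R | 0 <= t]].

Lemma sublinearZ p (c : R) x : sublinear p -> 0 <= c -> p (c *: x) = c * p x.
Proof.
move=> [p0 _ pZ]; rewrite le_eqVlt => /predU1P[<-|c0].
  by rewrite scale0r mul0r.
apply/eqP; rewrite eq_le pZ//= -ler_pdivlMl//.
by rewrite -{1}(scalerK (lt0r_neq0 c0) x) pZ// invr_gt0.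
Qed.

Lemma sublinearN p x : sublinear p -> 0 <= p x + p (- x).
Proof. by move=> [p0 pD _]; rewrite -p0 -(subrr x) pD. Qed.

Section Reduce.
Variables (p : V -> R) (u : V).
Hypothesis psub : sublinear p.
Let p' := sublinear_reduce p u.

Let lb x : has_lbound [set p (x + t *: u) - t * p u | t in [set t : R | 0 <= t]].
Proof.
exists (- p (- x)) => _ [t /= t0 <-]; rewrite lerBrDr -(sublinearZ u psub t0).
rewrite addrC -lerBrDr opprK; have [_ pD _] := psub.
by rewrite (le_trans _ (pD _ _))// addrC addrA addNr add0r.
Qed.

Let p'_le x t : 0 <= t -> p' x <= p (x + t *: u) - t * p u.
Proof. by move=> t0; apply: ge_inf; [exact: lb|exists t]. Qed.

Let p'_ge x m : (forall t, 0 <= t -> m <= p (x + t *: u) - t * p u) -> m <= p' x.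
Proof.
move=> H; apply: lb_le_inf; last by move=> _ [t /= t0 <-]; exact: H.
by exists (p (x + 0 *: u) - 0 * p u); exists 0 => /=.
Qed.

Lemma sublinear_reduce_le x : sublinear_reduce p u x <= p x.
Proof. by have := @p'_le x 0 (lexx _); rewrite scale0r addr0 mul0r subr0. Qed.

Lemma sublinear_reduce_sublinear : sublinear (sublinear_reduce p u).
Proof.
have [p0 pD pZ] := psub; split.
- apply/eqP; rewrite eq_le (le_trans (sublinear_reduce_le 0)) ?p0//=.
  by apply: p'_ge => t t0; rewrite add0r sublinearZ// subrr.
- move=> x y; rewrite -lerBlDr; apply: p'_ge => t t0.
  rewrite lerBlDr -lerBlDl; apply: p'_ge => r r0; rewrite lerBlDl.
  apply: (le_trans (p'_le _ (addr_ge0 r0 t0))).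
  rewrite mulrDl scalerDl.
  have := pD (y + r *: u) (x + t *: u); rewrite addrACA (addrC y).
  lra.
- move=> c x c0; rewrite -ler_pdivrMl//; apply: p'_ge => t t0.
  rewrite ler_pdivrMl// mulrBr mulrA.
  apply: (le_trans (p'_le _ (mulr_ge0 (ltW c0) t0))).
  by rewrite lerD2r -scalerA -scalerDr pZ.
Qed.

Lemma sublinear_reduce_odd x : p (- x) = - p x ->
  sublinear_reduce p u x = p x /\ sublinear_reduce p u (- x) = - p x.
Proof.
move=> px; have := sublinear_reduce_le x; have := sublinear_reduce_le (- x).
have := sublinearN x sublinear_reduce_sublinear; rewrite px.
by move=> *; split; lra.
Qed.

Lemma sublinear_reduce_at :
  sublinear_reduce p u u = p u /\ sublinear_reduce p u (- u) = - p u.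
Proof.
have := sublinear_reduce_le u.
have := sublinearN u sublinear_reduce_sublinear.
have := @p'_le (- u) 1 ler01; rewrite scale1r addNr mul1r /p'.
by have [-> _ _] := psub => *; split; lra.
Qed.

End Reduce.

(** One reduction per vector of [s] is enough because linearity is wanted only on a
    finite-dimensional span. The vectors at which the functional is already odd survive all later
    reductions. *)
Lemma sublinear_dominated p (s : seq V) : sublinear p ->
  exists p', [/\ sublinear p', (forall x, p' x <= p x),
    (forall x, p (- x) = - p x -> p' x = p x /\ p' (- x) = - p x) &
    forall u, u \in s -> p' (- u) = - p' u].
Proof.
elim: s p => [|u s IH] p psub; first by exists p; split.
have [p' [p'sub p'le p'odd p's]] := IH _ (sublinear_reduce_sublinear u psub).
exists p'; split => //.
- by move=> x; rewrite (le_trans (p'le x))// sublinear_reduce_le.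
- move=> x /(sublinear_reduce_odd u psub) [H1 H2].
  by rewrite -H1; apply: p'odd; rewrite H1 H2.
- move=> x; rewrite inE => /predU1P[->|/p's//].
  have [H1 H2] := sublinear_reduce_at u psub.
  have [|-> ->] := p'odd u; first by rewrite H1 H2.
  by rewrite H1.
Qed.

Lemma sublinear_additive p x u (c : R) : sublinear p -> p (- u) = - p u ->
  p (x + c *: u) = p x + c * p u.
Proof.
move=> psub pu; have [_ pD _] := psub.
have pZ d : p (d *: u) = d * p u.
  have [d0|/ltW d0] := leP 0 d; first by rewrite sublinearZ.
  by rewrite -[d]opprK scaleNr -scalerN sublinearZ ?oppr_ge0// pu; ring.
apply/eqP; rewrite eq_le -{1}pZ pD/=.
have := pD (x + c *: u) (- c *: u); rewrite pZ -addrA -scalerDl subrr scale0r addr0.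
by rewrite mulNr; lra.
Qed.

End FiniteHahnBanach.

(** The coefficients are the values at the [w k] of a functional below the norm, linear on the span
    of [z] and the [w k], and equal to [|z|] at [z]. The reduction at [z] comes first, so that the
    value there is still the norm; afterwards it is frozen by oddness. *)
Lemma norming_coefficients (R : realType) (X : normedModType R) N (w : 'I_N -> X)
    (z : X) : exists a : 'I_N -> R, forall (c : R) (y : 'I_N -> R),
  c * `|z| + \sum_(k < N) y k * a k <= `|c *: z + \sum_(k < N) y k *: w k|.
Proof.
have nsub : sublinear (fun x : X => `|x|).
  split; [exact: normr0|exact: ler_normD|].
  by move=> c x c0; rewrite normrZ gtr0_norm.
have rsub := sublinear_reduce_sublinear z nsub.
have [r1 r2] := sublinear_reduce_at z nsub.
have [p [psub ple podd ps]] := sublinear_dominated (codom w) rsub.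
have [|pz pNz] := podd z; first by rewrite r1 r2.
exists (p \o w) => c y.
suff H : p (c *: z + \sum_(k < N) y k *: w k) = c * `|z| + \sum_(k < N) y k * p (w k).
  by rewrite -H (le_trans (ple _))// (sublinear_reduce_le z nsub).
have pzz : p (- z) = - p z by rewrite pNz pz.
have p0 : p 0 = 0 by case: psub.
rewrite -[c *: z]add0r.
elim/big_rec2: _ => [|k r x _ IH].
  by rewrite !addr0 (sublinear_additive _ _ psub pzz) p0 add0r pz r1.
by rewrite (addrC (y k *: _)) addrA sublinear_additive ?IH ?ps ?codom_f//; lra.
Qed.

(** * Dvoretzky-Rogers vectors *)

(** Both sides are the determinant of one block matrix, triangularized by eliminating either of its
    identity blocks. *)
Lemma det_rank_one (R : comNzRingType) n (u : 'cV[R]_n) (v : 'rV[R]_n) :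
  \det (1%:M + u *m v) = 1 + (v *m u) 0 0.
Proof.
pose B := block_mx (1%:M : 'M[R]_1) (- v) u 1%:M.
have E1 : B = block_mx 1%:M 0 u 1%:M *m block_mx (1%:M : 'M[R]_1) (- v) 0 (1%:M + u *m v).
  by rewrite mulmx_block !mul1mx !mulmx0 !mul0mx ?mulmx1 !addr0 mulmxN addrCA addNr addr0.
have E2 : B = block_mx (1%:M : 'M[R]_1) (- v) 0 1%:M *m block_mx (1%:M + v *m u) 0 u 1%:M.
  by rewrite mulmx_block !mul1mx !mulmx0 !mul0mx ?mulmx1 mulNmx addrK !add0r.
transitivity (\det B); first by rewrite E1 det_mulmx det_lblock det_ublock !det1 !mul1r.
rewrite E2 det_mulmx det_lblock det_ublock !det1 !mul1r mulr1.
by rewrite [1%:M + _]mx11_scalar det_scalar1 !mxE eqxx.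
Qed.

Section EuclideanRows.
Variables (R : rcfType) (N : nat).
Implicit Types s t : 'rV[R]_N.

Definition dotp s t : R := (s *m t^T) 0 0.
Definition norm2 s : R := Num.sqrt (dotp s s).

Lemma dotpE s t : dotp s t = \sum_(k < N) s 0 k * t 0 k.
Proof. by rewrite /dotp mxE; apply: eq_bigr => k _; rewrite mxE. Qed.

Lemma dotp_ge0 s : 0 <= dotp s s.
Proof. by rewrite dotpE; apply: sumr_ge0 => k _; rewrite -expr2 sqr_ge0. Qed.

Lemma sqr_norm2 s : norm2 s ^+ 2 = dotp s s.
Proof. by rewrite sqr_sqrtr// dotp_ge0. Qed.

Lemma norm2_ge0 s : 0 <= norm2 s. Proof. exact: sqrtr_ge0. Qed.

Lemma norm2_eq0 s : norm2 s = 0 -> s = 0.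
Proof.
move=> s0; have := sqr_norm2 s; rewrite s0 expr0n/= dotpE => /esym/eqP.
rewrite psumr_eq0; last by move=> k _; rewrite -expr2 sqr_ge0.
move=> /allP sk; apply/rowP => k; rewrite mxE.
by have := sk k (mem_index_enum _); rewrite /= mulf_eq0 orbb => /eqP.
Qed.

Lemma dotpZ a s : dotp (a *: s) (a *: s) = a ^+ 2 * dotp s s.
Proof. by rewrite /dotp linearZ /= -scalemxAl -scalemxAr scalerA mxE expr2. Qed.

Lemma norm2Z a s : norm2 (a *: s) = `|a| * norm2 s.
Proof. by rewrite /norm2 dotpZ sqrtrM ?sqr_ge0// sqrtr_sqr. Qed.

Lemma norm2_proj (P : 'M[R]_N) s : P^T = P -> P *m P = P -> norm2 (s *m P) <= norm2 s.
Proof.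
move=> PT PP; rewrite /norm2 ler_wsqrtr// -subr_ge0.
suff -> : dotp s s - dotp (s *m P) (s *m P) = dotp (s *m (1%:M - P)) (s *m (1%:M - P)).
  exact: dotp_ge0.
have dotM (M : 'M[R]_N) : M^T = M -> M *m M = M ->
    dotp (s *m M) (s *m M) = (s *m M *m s^T) 0 0.
  by move=> MT MM; rewrite /dotp trmx_mul MT !mulmxA -(mulmxA s M M) MM.
rewrite !dotM//.
- by rewrite /dotp mulmxBr mulmx1 mulmxBl !mxE.
- by rewrite linearB /= tr_scalar_mx PT.
- by rewrite mulmxBl mul1mx mulmxBr mulmx1 PP subrr subr0.
Qed.

End EuclideanRows.

Section DvoretzkyRogers.
Variables (R : realType) (X : normedModType R).

Section Matrices.
Variables (N : nat) (e : 'I_N -> X).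
Hypothesis e_free : lin_indep e.
Hypothesis N_gt0 : (0 < N)%N.

Definition row_vector (s : 'rV[R]_N) : X := \sum_(i < N) s 0 i *: e i.

Lemma row_vectorD s t : row_vector (s + t) = row_vector s + row_vector t.
Proof. by rewrite -big_split; apply: eq_bigr => i _; rewrite mxE scalerDl. Qed.

Lemma row_vectorZ a s : row_vector (a *: s) = a *: row_vector s.
Proof. by rewrite scaler_sumr; apply: eq_bigr => i _; rewrite mxE scalerA. Qed.

Lemma row_vector_bounded_below : exists2 C : R, 0 <= C &
  forall (s : 'rV[R]_N) (i : 'I_N), `|s 0 i| <= C * `|row_vector s|.
Proof.
pose S := [set s : 'rV[R]_N | `|s| = 1].
have cS : compact S.
  apply: bounded_closed_compact.
    by exists 1; split => // M M1 s; rewrite /S /= => ->; exact: ltW.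
  apply: (@preimage_closed _ _ (fun s : 'rV[R]_N => `|s|) [set 1]).
    by move=> s _; exact: norm_continuous.
  exact: closed_eq.
have S0 : S !=set0.
  pose x : 'rV[R]_N := const_mx 1.
  have x0 : x != 0.
    apply/eqP => /rowP/(_ (Ordinal N_gt0)); rewrite !mxE => /eqP.
    by rewrite oner_eq0.
  exists (`|x|^-1 *: x); rewrite /S /= normrZ ger0_norm ?invr_ge0//.
  by rewrite mulVf// normr_eq0.
have ce i : continuous (fun s : 'rV[R]_N => s 0 i *: e i).
  move=> t; apply: (@continuous_comp _ _ _ (fun s : 'rV[R]_N => s 0 i : R^o) (fun r : R^o => r *: e i)).
    exact: coord_continuous.
  exact: scalel_continuous.
have cL : continuous (fun s => `|row_vector s|).
  move=> s; apply: continuous_comp; last exact: norm_continuous.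
  apply: (@continuous_big _ _ _ _ _ add_continuous _ _ (fun i (s : 'rV[R]_N) => s 0 i *: e i)).
  by move=> i _; exact: ce.
have [c cS1 cmin] := compact_EVT_min S0 cS (continuous_subspaceT cL).
have c1 : `|c| = 1 by move/set_mem: cS1.
have Lc : 0 < `|row_vector c|.
  rewrite normr_gt0; apply/eqP => /e_free c0.
  suff c00 : c = 0 by move: c1; rewrite c00 normr0 => /esym/eqP; rewrite oner_eq0.
  by apply/rowP => i; rewrite mxE c0.
exists `|row_vector c|^-1; first by rewrite invr_ge0.
move=> s i; have [->|s0] := eqVneq s 0; first by rewrite mxE normr0 mulr_ge0 ?invr_ge0.
have ns : 0 < `|s| by rewrite normr_gt0.
apply: (@le_trans _ _ `|s|).
  rewrite -[leRHS]/(mx_norm s) mx_normrE.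
  by apply: (le_bigmax _ (fun ij => `|s ij.1 ij.2|) (0, i)).
rewrite ler_pdivlMl//.
have := cmin (`|s|^-1 *: s); rewrite row_vectorZ normrZ ger0_norm ?invr_ge0// ler_pdivlMl//.
rewrite mulrC; apply; rewrite inE /S /= normrZ ger0_norm ?invr_ge0// mulVf ?lt0r_neq0//.
Qed.

(** The Euclidean unit ball is sent to an ellipsoid (possibly degenerate) inside the unit ball of
    the span of [e], and [|\det A|] is proportional to its volume. *)
Definition contraction (A : 'M[R]_N) : Prop :=
  forall t, `|row_vector (t *m A)| <= norm2 t.

Lemma contraction_det_bounded : exists B : R, forall A, contraction A -> `|\det A| <= B.
Proof.
have [C C0 HC] := row_vector_bounded_below.
exists (\sum_(s : 'S_N) C ^+ N) => A cA.
have n2d j : norm2 (delta_mx 0 j : 'rV[R]_N) = 1.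
  rewrite /norm2 dotpE (bigD1 j)//= big1 ?addr0.
    by rewrite mxE !eqxx mulr1 sqrtr1.
  by move=> k kj; rewrite mxE (negbTE kj) andbF mul0r.
have Aij j i : `|A j i| <= C.
  have := HC (row j A) i; rewrite mxE => /le_trans; apply.
  rewrite -[leRHS]mulr1 ler_wpM2l//.
  by have := cA (delta_mx 0 j); rewrite n2d -rowE.
rewrite /determinant; apply: (le_trans (ler_norm_sum _ _ _)); apply: ler_sum => s _.
rewrite normrM normrX normrN1 expr1n mul1r normr_prod.
rewrite -[leRHS](_ : \prod_(i < N) C = _); last by rewrite prodr_const card_ord.
by apply: ler_prod => i _; rewrite normr_ge0 Aij.
Qed.

Lemma contraction_det_pos : exists2 A, contraction A & 0 < \det A.
Proof.
pose K := 1 + \sum_(i < N) `|e i|.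
have K0 : 0 < K by rewrite ltr_pwDl// sumr_ge0.
exists (K^-1)%:M; last by rewrite det_scalar exprn_gt0// invr_gt0.
move=> t; rewrite mul_mx_scalar row_vectorZ normrZ ger0_norm ?invr_ge0 ?(ltW K0)//.
rewrite ler_pdivrMl//; apply: (le_trans (ler_norm_sum _ _ _)).
have tk k : `|t 0 k| <= norm2 t.
  rewrite -[leLHS]sqrtr_sqr ler_wsqrtr// dotpE (bigD1 k)//= expr2 lerDl.
  by apply: sumr_ge0 => j _; rewrite -expr2 sqr_ge0.
apply: (@le_trans _ _ (\sum_(i < N) `|e i| * norm2 t)).
  by apply: ler_sum => i _; rewrite normrZ mulrC ler_wpM2l.
by rewrite -mulr_suml ler_wpM2r ?norm2_ge0// /K lerDr.
Qed.

Lemma contraction_perturb A P (b : R) : 0 <= b -> contraction A ->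
  (forall t, `|row_vector (t *m P *m A)| <= b * norm2 t) ->
  contraction ((1 + b)^-1 *: ((1%:M + P) *m A)).
Proof.
move=> b0 cA cP t; have b1 : 0 < 1 + b by rewrite ltr_pwDl.
rewrite -scalemxAr row_vectorZ normrZ ger0_norm ?invr_ge0 ?(ltW b1)//.
rewrite ler_pdivrMl// mulrDl mul1r mulmxA mulmxDr mulmx1 mulmxDl row_vectorD.
by rewrite (le_trans (ler_normD _ _))// lerD.
Qed.

End Matrices.

(* The vectors come from a contraction of almost maximal determinant: if it
   were small on the range of a projection [P] of large rank, [1 + P] would
   increase the determinant too much. *)
Lemma dvoretzky_rogers m : infinite_dim X -> exists w : 'I_m -> X,
  (forall i, 4^-1 <= `|w i|) /\
  forall c : 'I_m -> R, `|\sum_(i < m) c i *: w i| <= Num.sqrt (\sum_(i < m) c i ^+ 2).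
Proof.
(* Twice as many dimensions as vectors: after fewer than [m] directions have been removed, the
   remaining projection still has rank at least [m]. *)
move=> /(_ (m + m)%N) [e e_free].
have [->|m0] := posnP m.
  exists (fun=> 0); split => [[]//|c].
  by rewrite !big_ord0 normr0 sqrtr_ge0.
have N0 : (0 < m + m)%N by rewrite addn_gt0 m0.
set N := (m + m)%N in e e_free N0.
pose S := [set r | exists2 A, contraction e A & r = `|\det A|].
have [B SB] := contraction_det_bounded e_free N0.
have Sub : has_ubound S by exists B => _ [A cA ->]; exact: SB.
have [A0 cA0 detA0] := contraction_det_pos e.
have S0 : 0 < sup S.
  apply: (lt_le_trans detA0); apply: (le_trans (ler_norm _)).
  by apply: ub_le_sup => //; exists A0.
have Shas : has_sup S by split => //; exists `|\det A0|, A0.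
(* If [A] had norm below 1/4 on a range of dimension at least [m], passing to [(1 + P) A] would gain
   a factor of at least [2 ^ m], while rescaling by [4/5] in dimension [2 m] costs [(16/25) ^ m].
   The net gain [q] exceeds 1, so a determinant within a factor [q] of the supremum is enough. *)
pose q : R := (32 / 25) ^+ m.
have q1 : 1 < q by rewrite exprn_egt1 ?lt0n_neq0//; lra.
have [_ [A cA ->] Aq] : exists2 r, S r & sup S / q < r.
  have e0 : 0 < sup S - sup S / q.
    by rewrite subr_gt0 ltr_pdivrMr ?(lt_trans _ q1)// ltr_pMr.
  have [r Sr rq] := sup_adherent e0 Shas; exists r => //.
  by rewrite opprB addrC subrK in rq.
pose L := row_vector e.
have big_direction (P : 'M[R]_N) : P^T = P -> P *m P = P -> 2 ^+ m <= \det (1%:M + P) ->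
    exists t, [/\ t *m P = t, norm2 t = 1 & 4^-1 <= `|L (t *m A)|].
  move=> PT PP detP; apply: contrapT => H.
  have small t : `|L (t *m P *m A)| <= 4^-1 * norm2 t.
    have [tP0|tP0] := eqVneq (norm2 (t *m P)) 0.
      rewrite (norm2_eq0 tP0) mul0mx -(scale0r (0 : 'rV_N)) /L row_vectorZ scale0r normr0.
      by rewrite mulr_ge0// norm2_ge0.
    have n0 : 0 < norm2 (t *m P) by rewrite lt_neqAle eq_sym tP0 norm2_ge0.
    rewrite leNgt; apply/negP => big; apply: H.
    exists ((norm2 (t *m P))^-1 *: (t *m P)); split.
    - by rewrite -scalemxAl -mulmxA PP.
    - by rewrite norm2Z ger0_norm ?invr_ge0 ?(ltW n0)// mulVf.
    - rewrite -scalemxAl /L row_vectorZ normrZ ger0_norm ?invr_ge0 ?(ltW n0)//.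
      rewrite ler_pdivlMl// (le_trans _ (ltW big))// mulrC ler_wpM2l//.
      exact: norm2_proj.
  have b0 : 0 <= 4^-1 :> R by [].
  have := contraction_perturb b0 cA small.
  move=> cA'; have : `|\det ((1 + 4^-1)^-1 *: ((1%:M + P) *m A))| <= sup S.
    by apply: ub_le_sup => //; eexists; [exact: cA'|].
  rewrite detZ det_mulmx !normrM => H1.
  have : sup S < sup S; last by rewrite ltxx.
  have q0 := lt_trans ltr01 q1.
  rewrite {1}(_ : sup S = q * (sup S / q)); last by rewrite mulrCA mulfV ?mulr1// gt_eqF.
  apply: (@lt_le_trans _ _ (q * `|\det A|)); first by rewrite ltr_pM2l.
  apply: le_trans H1; rewrite mulrA ler_wpM2r// ger0_norm; last first.
    by rewrite exprn_ge0// invr_ge0.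
  apply: (@le_trans _ _ ((1 + 4^-1)^-1 ^+ N * 2 ^+ m)); last first.
    by rewrite ler_wpM2l ?exprn_ge0 ?invr_ge0// (le_trans detP)// ler_norm.
  rewrite /N exprD -!exprMn /q (_ : 32 / 25 = (1 + 4^-1)^-1 * (1 + 4^-1)^-1 * 2)//.
  by field.
(* [P] is the orthogonal projection onto the complement of the rows chosen so far; its rank [N - j]
   is recorded by [\det (1%:M + P)], the form in which [big_direction] needs it. *)
have greedy j : (j <= m)%N -> exists (t : nat -> 'rV[R]_N) (P : 'M[R]_N),
    [/\ P^T = P /\ P *m P = P, (forall i, (i < j)%N -> t i *m P = 0),
        (forall i k, (i < j)%N -> (k < j)%N -> t i *m (t k)^T = (i == k)%:R%:M),
        (forall i, (i < j)%N -> 4^-1 <= `|L (t i *m A)|) &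
        \det (1%:M + P) = 2 ^+ (N - j)].
  elim: j => [_|j IH jm].
    exists (fun=> 0), 1%:M; split => //; first by rewrite trmx1 mulmx1.
    by rewrite subn0 -(det_scalar N (2 : R)) -raddfD.
  have [t [P [[PT PP] tP tt tA detP]]] := IH (ltnW jm).
  have [|t' [t'P t'1 t'A]] := big_direction P PT PP.
    by rewrite detP ler_weXn2l ?ler1n// /N -addnBA ?leq_addr// ltnW.
  have Pt' : P *m t'^T = t'^T by rewrite -{2}t'P trmx_mul PT.
  have t't' : t' *m t'^T = 1%:M.
    rewrite [LHS]mx11_scalar -[(t' *m t'^T) 0 0]/(dotp t' t') -sqr_norm2 t'1.
    by rewrite expr1n.
  have ttj i : (i < j)%N -> t i *m t'^T = 0 by move=> ij; rewrite -Pt' mulmxA tP// mul0mx.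
  exists (fun i => if i == j then t' else t i), (P - t'^T *m t'); split.
  - split; first by rewrite linearB /= PT trmx_mul trmxK.
    rewrite mulmxBl !mulmxBr PP -(mulmxA _ t' P) t'P mulmxA Pt'.
    by rewrite -(mulmxA _ t') (mulmxA t') t't' mul1mx subrr subr0.
  - move=> i; rewrite ltnS leq_eqVlt => /predU1P[->|ij].
      by rewrite eqxx mulmxBr t'P mulmxA t't' mul1mx subrr.
    by rewrite ltn_eqF// mulmxBr tP// mulmxA ttj// mul0mx subrr.
  - move=> i k; rewrite !ltnS (leq_eqVlt i) (leq_eqVlt k) => /predU1P[->|ij] /predU1P[->|kj].
    + by rewrite !eqxx t't'.
    + rewrite eqxx ltn_eqF// eq_sym ltn_eqF// -[LHS]trmxK trmx_mul trmxK ttj//.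
      by apply/matrixP => a b; rewrite !mxE mul0rn.
    + by rewrite eqxx ltn_eqF// ttj//; apply/matrixP => a b; rewrite !mxE mul0rn.
    + by rewrite (ltn_eqF ij) (ltn_eqF kj) tt.
  - move=> i; rewrite ltnS leq_eqVlt => /predU1P[->|ij]; first by rewrite eqxx.
    by rewrite ltn_eqF// tA.
  (* Since [P] fixes [t'^T], removing the direction [t'] multiplies [1 + P] by a rank-one
     perturbation of the identity whose determinant is 1/2. *)
  - have -> : 1%:M + (P - t'^T *m t') =
        (1%:M + P) *m (1%:M + (- 2^-1 *: t'^T) *m t').
      rewrite mulmxDr mulmx1 mulmxA -scalemxAr mulmxDl mul1mx Pt' -scalemxAl.
      rewrite mulmxDl scalerDr -scalerDl (_ : - 2^-1 - 2^-1 = -1 :> R); last by field.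
      by rewrite scaleN1r addrA.
    rewrite det_mulmx det_rank_one detP -scalemxAr t't' !mxE eqxx.
    have -> : (N - j = (N - j.+1).+1)%N.
      by rewrite subnSK// (leq_trans jm)// leq_addr.
    by rewrite mulr1n mulr1 exprSr -mulrA (_ : 2 * _ = 1) ?mulr1//; field.
have [t [P [_ _ tt tA _]]] := greedy m (leqnn m).
exists (fun i => L (t i *m A)); split => [i|c]; first exact: tA.
pose s := \sum_(i < m) c i *: t i.
have -> : \sum_(i < m) c i *: L (t i *m A) = L (s *m A).
  rewrite /s mulmx_suml; elim/big_rec2: _ => [|i y x _ ->].
    by rewrite -(scale0r (0 : 'rV_N)) /L row_vectorZ scale0r.
  by rewrite /L row_vectorD -scalemxAl row_vectorZ.
apply: (le_trans (cA s)); rewrite /norm2 ler_wsqrtr// /dotp /s.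
rewrite mulmx_suml summxE; apply: ler_sum => i _.
rewrite linear_sum /= -scalemxAl mulmx_sumr mxE summxE.
rewrite (bigD1 i)//= big1 ?addr0; last first.
  move=> k ki; rewrite linearZ /= -scalemxAr tt// eq_sym -val_eqE/= in ki *.
  by rewrite (negbTE ki) mxE !mxE mul0rn mulr0.
by rewrite linearZ /= -scalemxAr tt// eqxx !mxE mulr1 expr2.
Qed.

End DvoretzkyRogers.

(** * Integrals of nonnegative real functions and finiteness of second moments *)

Section RealIntegrals.
Variables (R : realType) (d : measure_display) (T : measurableType d).
Variable P : {measure set T -> \bar R}.
Implicit Types f h : T -> R.

Lemma le_integral_EFin f h : measurable_fun setT f -> measurable_fun setT h ->
  (forall x, 0 <= f x) -> (forall x, f x <= h x) ->
  (\int[P]_x (f x)%:E <= \int[P]_x (h x)%:E)%E.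
Proof.
move=> mf mh f0 fh; apply: ge0_le_integral => //.
- by move=> x _; rewrite lee_fin.
- exact/measurable_EFinP.
- exact/measurable_EFinP.
- by move=> x _; rewrite lee_fin.
Qed.

Lemma integralZ_EFin k f : measurable_fun setT f -> (forall x, 0 <= f x) -> 0 <= k ->
  (\int[P]_x (k * f x)%:E = k%:E * \int[P]_x (f x)%:E)%E.
Proof.
move=> mf f0 k0; under eq_integral do rewrite EFinM.
apply: ge0_integralZl => //; first exact/measurable_EFinP.
by move=> x _; rewrite lee_fin.
Qed.

Lemma integralD_EFin f h : measurable_fun setT f -> measurable_fun setT h ->
  (forall x, 0 <= f x) -> (forall x, 0 <= h x) ->
  (\int[P]_x (f x + h x)%:E = \int[P]_x (f x)%:E + \int[P]_x (h x)%:E)%E.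
Proof.
move=> mf mh f0 h0; under eq_integral do rewrite EFinD.
apply: ge0_integralD => //.
- by move=> x _; rewrite lee_fin.
- exact/measurable_EFinP.
- by move=> x _; rewrite lee_fin.
- exact/measurable_EFinP.
Qed.

Lemma integral_sum_EFin (I : Type) (r : seq I) (F : I -> T -> R) :
  (forall i, measurable_fun setT (F i)) -> (forall i x, 0 <= F i x) ->
  (\int[P]_x (\sum_(i <- r) F i x)%:E = \sum_(i <- r) \int[P]_x (F i x)%:E)%E.
Proof.
move=> mF F0; under eq_integral do rewrite -sumEFin.
apply: ge0_integral_sum => //; first by move=> i; exact/measurable_EFinP.
by move=> i x _; rewrite lee_fin.
Qed.

End RealIntegrals.

Lemma norm_lincomb_sqr_bound (R : realType) (X : normedModType R) N (w : 'I_N -> X) :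
  exists2 C : R, 0 <= C & forall a : 'I_N -> R,
    `|\sum_(k < N) a k *: w k| ^+ 2 <= C * \sum_(k < N) a k ^+ 2.
Proof.
elim: N w => [|N IH] w.
  by exists 0 => // a; rewrite big_ord0 normr0 expr0n mul0r.
have [C C0 HC] := IH (fun i => w (widen_ord (leqnSn N) i)).
exists (2 * C + 2 * `|w ord_max| ^+ 2); first by rewrite addr_ge0// mulr_ge0// sqr_ge0.
move=> a; rewrite !big_ord_recr /=.
set V := \sum_(i < N) a (widen_ord (leqnSn N) i) *: w (widen_ord (leqnSn N) i).
set S := \sum_(i < N) a (widen_ord (leqnSn N) i) ^+ 2.
have VS : `|V| ^+ 2 <= C * S := HC (fun i => a (widen_ord (leqnSn N) i)).
have S0 : 0 <= S by apply: sumr_ge0 => i _; exact: sqr_ge0.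
have VY := ler_normD V (a ord_max *: w ord_max).
have YE : `|a ord_max *: w ord_max| ^+ 2 = a ord_max ^+ 2 * `|w ord_max| ^+ 2.
  by rewrite normrZ exprMn real_normK ?num_real.
apply: (@le_trans _ _ (2 * `|V| ^+ 2 + 2 * `|a ord_max *: w ord_max| ^+ 2)).
  have := normr_ge0 (V + a ord_max *: w ord_max).
  have := sqr_ge0 (`|V| - `|a ord_max *: w ord_max|); nra.
rewrite YE; have := sqr_ge0 (a ord_max); have := sqr_ge0 `|w ord_max|; nra.
Qed.

Section SecondMoments.
Variables (R : realType) (d : measure_display) (T : measurableType d).
Variables (P : {measure set T -> \bar R}) (g : nat -> T -> R).
Hypothesis gP : gaussian_sequence P g.

Lemma gaussian_coord_second_moment k : (\int[P]_w (g k w ^+ 2)%:E = 1)%E.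
Proof.
have := gaussian_second_moment k.+1 (fun i => (i == k)%:R) gP.
rewrite (bigD1 ord_max)//= eqxx expr1n big1 ?addr0; last first.
  by move=> i; rewrite -val_eqE/= => /negbTE->; rewrite expr0n.
move=> <-; apply: eq_integral => w _; rewrite (bigD1 ord_max)//= eqxx mul1r big1 ?addr0//.
by move=> i; rewrite -val_eqE/= => /negbTE->; rewrite mul0r.
Qed.

Variables (X : normedModType R) (N : nat) (w : 'I_N -> X).

Lemma measurable_norm_gaussian_vector a :
  measurable_fun setT (fun t => `|gaussian_vector w g a t|).
Proof. by apply: measurable_norm_lincomb => k; exact: gP.1. Qed.

Lemma gaussian_vector_sqr_lty a :
  (\int[P]_t (`|gaussian_vector w g a t| ^+ 2)%:E < +oo)%E.
Proof.
have [C C0 HC] := norm_lincomb_sqr_bound w.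
have mg2 k : measurable_fun setT (fun t => g (a + k)%N t ^+ 2).
  by apply: measurable_funX; exact: gP.1.
apply: (@le_lt_trans _ _ (\int[P]_t (C * \sum_(k < N) g (a + k)%N t ^+ 2)%:E)%E).
  apply: le_integral_EFin => [|||t].
  - by apply: measurable_funX; exact: measurable_norm_gaussian_vector.
  - by apply: measurable_funM => //; apply: measurable_sum => k.
  - by move=> t; exact: sqr_ge0.
  - exact: HC.
rewrite integralZ_EFin//; last 2 first.
- by apply: measurable_sum => k.
- by move=> t; apply: sumr_ge0 => k _; exact: sqr_ge0.
rewrite integral_sum_EFin//; last by move=> k t; exact: sqr_ge0.
under eq_bigr do rewrite gaussian_coord_second_moment.
by rewrite sumEFin -EFinM ltry.
Qed.

End SecondMoments.

(** * Concentration of Gaussian norms *)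

Section RotationIncrement.
Variables (R : realType) (X : normedModType R) (N : nat) (w : 'I_N -> X).

(** Only decreases of the norm count: a functional norming [u] bounds [|v|] from below, which
    controls this side of the difference. *)
Definition norm_drop (u v : X) : R := Num.max 0 (`|u| - `|v|) ^+ 2.

Lemma norm_drop_ge0 u v : 0 <= norm_drop u v. Proof. exact: sqr_ge0. Qed.

Lemma norm_drop_trans u v x : norm_drop u x <= 2 * norm_drop u v + 2 * norm_drop v x.
Proof.
rewrite /norm_drop.
have [p0 pu] : 0 <= Num.max 0 (`|u| - `|v|) /\ `|u| - `|v| <= Num.max 0 (`|u| - `|v|).
  by rewrite !le_max !lexx orbT.
have [q0 qu] : 0 <= Num.max 0 (`|v| - `|x|) /\ `|v| - `|x| <= Num.max 0 (`|v| - `|x|).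
  by rewrite !le_max !lexx orbT.
have [r0 ru] : 0 <= Num.max 0 (`|u| - `|x|) /\
    Num.max 0 (`|u| - `|x|) <= Num.max 0 (`|u| - `|v|) + Num.max 0 (`|v| - `|x|).
  by split; [rewrite le_max lexx|rewrite ge_max; apply/andP; split; lra].
have := sqr_ge0 (Num.max 0 (`|u| - `|v|) - Num.max 0 (`|v| - `|x|)).
move: (Num.max 0 (`|u| - `|x|)) (Num.max 0 (`|u| - `|v|)) (Num.max 0 (`|v| - `|x|)) r0 ru p0 q0 pu qu.
move=> *; nra.
Qed.

(** At [c = 0], [s = 1] two independent copies are compared; at small angles, nearby points. *)
Definition rotation_increment d (T : measurableType d) (Q : {measure set T -> \bar R})
    (h : nat -> T -> R) (c s : R) : \bar R :=
  (\int[Q]_z (norm_drop (gaussian_vector w h 0 z)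
    (c *: gaussian_vector w h 0 z - s *: gaussian_vector w h N z))%:E)%E.

Lemma gaussian_vector_comb (T : Type) (h : nat -> T -> R) (a b : nat) (c s : R) z :
  c *: gaussian_vector w h a z - s *: gaussian_vector w h b z =
  \sum_(k < N) (c * h (a + k)%N z - s * h (b + k)%N z) *: w k.
Proof.
by rewrite /gaussian_vector !scaler_sumr -sumrB; apply: eq_bigr => k _; rewrite scalerBl !scalerA.
Qed.

Lemma measurable_norm_drop d (T : measurableType d) (h1 h2 : 'I_N -> T -> R) :
  (forall k, measurable_fun setT (h1 k)) -> (forall k, measurable_fun setT (h2 k)) ->
  measurable_fun setT (fun z => norm_drop (\sum_(k < N) h1 k z *: w k) (\sum_(k < N) h2 k z *: w k)).
Proof.
move=> m1 m2; apply: measurable_funX; apply: measurable_maxr => //.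
by apply: measurable_funB; exact: measurable_norm_lincomb.
Qed.

Lemma rotation_increment_law d1 (T1 : measurableType d1) (Q1 : {measure set T1 -> \bar R})
    (h1 : nat -> T1 -> R) d2 (T2 : measurableType d2) (Q2 : {measure set T2 -> \bar R})
    (h2 : nat -> T2 -> R) (c s : R) :
  gaussian_sequence Q1 h1 -> gaussian_sequence Q2 h2 ->
  rotation_increment Q1 h1 c s = rotation_increment Q2 h2 c s.
Proof.
move=> G1 G2.
pose H (t : (N + N).-tuple R) : \bar R :=
  (norm_drop (\sum_(k < N) tnth t (lshift N k) *: w k)
   (\sum_(k < N) (c * tnth t (lshift N k) - s * tnth t (rshift N k)) *: w k))%:E.
have E (T : Type) (h : nat -> T -> R) z : (norm_drop (gaussian_vector w h 0 z)
    (c *: gaussian_vector w h 0 z - s *: gaussian_vector w h N z))%:E = H (gtuple h (N + N) z).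
  rewrite gaussian_vector_comb /H; congr (norm_drop _ _)%:E.
    by apply: eq_bigr => k _; rewrite tnth_mktuple.
  by apply: eq_bigr => k _; rewrite !tnth_mktuple.
rewrite /rotation_increment; under eq_integral do rewrite E.
under [RHS]eq_integral do rewrite E.
apply: gaussian_law_unique => //; last by move=> t; rewrite lee_fin norm_drop_ge0.
apply/measurable_EFinP; apply: measurable_norm_drop => k; first exact: measurable_tnth.
by apply: measurable_funB; apply: measurable_funM => //; exact: measurable_tnth.
Qed.

(** [V1] lies halfway on the rotation from [V0] to [V2]. The rotated sequence is again Gaussian, so
    the pair [(V1, V2)] has the law of [(V0, V1)], and [norm_drop_trans] contributes [2 + 2]. *)
Lemma rotation_increment_double d (T : measurableType d) (Q : {measure set T -> \bar R})
    (h : nat -> T -> R) (c s : R) : gaussian_sequence Q h -> c ^+ 2 + s ^+ 2 = 1 ->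
  (rotation_increment Q h (2 * c ^+ 2 - 1) (2 * c * s) <= 4%:E * rotation_increment Q h c s)%E.
Proof.
move=> hQ cs.
pose h' := rotate_block 0 N N c s h.
have h'Q : gaussian_sequence Q h' by exact: gaussian_sequence_rotate_block.
pose V0 z := gaussian_vector w h 0 z.
pose V1 z := c *: gaussian_vector w h 0 z - s *: gaussian_vector w h N z.
pose V2 z := (2 * c ^+ 2 - 1) *: gaussian_vector w h 0 z - (2 * c * s) *: gaussian_vector w h N z.
have h'0 z : gaussian_vector w h' 0 z = V1 z.
  rewrite /V1 gaussian_vector_comb; apply: eq_bigr => k _.
  by rewrite /h' /rotate_block !add0n ltn_ord subn0.
have h'N z : c *: gaussian_vector w h' 0 z - s *: gaussian_vector w h' N z = V2 z.
  rewrite /V2 !gaussian_vector_comb; apply: eq_bigr => k _; congr (_ *: _).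
  have Nk : (N + k < N)%N = false by rewrite ltnNge leq_addr.
  rewrite /h' /rotate_block !add0n ltn_ord subn0 Nk leq_addr /= addKn ltn_add2l ltn_ord.
  have -> : 2 * c ^+ 2 - 1 = c ^+ 2 - s ^+ 2 by lra.
  by ring.
have m01 : measurable_fun setT (fun z => norm_drop (V0 z) (V1 z)).
  under eq_fun do rewrite /V1 gaussian_vector_comb.
  apply: measurable_norm_drop => k; first exact: hQ.1.
  by apply: measurable_funB; apply: measurable_funM => //; exact: hQ.1.
have m02 : measurable_fun setT (fun z => norm_drop (V0 z) (V2 z)).
  under eq_fun do rewrite /V2 gaussian_vector_comb.
  apply: measurable_norm_drop => k; first exact: hQ.1.
  by apply: measurable_funB; apply: measurable_funM => //; exact: hQ.1.
have m12 : measurable_fun setT (fun z => norm_drop (V1 z) (V2 z)).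
  under eq_fun do rewrite /V1 /V2 !gaussian_vector_comb.
  by apply: measurable_norm_drop => k;
    apply: measurable_funB; apply: measurable_funM => //; exact: hQ.1.
have E12 : (\int[Q]_z (norm_drop (V1 z) (V2 z))%:E = rotation_increment Q h c s)%E.
  rewrite -(rotation_increment_law c s h'Q hQ); apply: eq_integral => z _.
  by rewrite h'N h'0.
apply: (@le_trans _ _ (\int[Q]_z (2 * norm_drop (V0 z) (V1 z) + 2 * norm_drop (V1 z) (V2 z))%:E)%E).
  apply: le_integral_EFin => //.
  - by apply: measurable_funD; exact: measurable_funM.
  - by move=> z; exact: norm_drop_ge0.
  - by move=> z; exact: norm_drop_trans.
have p01 z := norm_drop_ge0 (V0 z) (V1 z); have p12 z := norm_drop_ge0 (V1 z) (V2 z).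
rewrite integralD_EFin; [|exact: measurable_funM|exact: measurable_funM| |]; last 2 first.
- by move=> z; rewrite mulr_ge0.
- by move=> z; rewrite mulr_ge0.
rewrite !integralZ_EFin// E12 -[X in (2%:E * X + _)%E]/(rotation_increment Q h c s).
by rewrite -ge0_muleDl ?lee_fin// -EFinD -natrD.
Qed.

(* Halving the angle divides the increment by at most 4, whereas [1 - c], whose
   square bounds the increment relative to [M ^+ 2], is divided by at least 3. *)
Lemma rotation_increment_halved k : exists c s : R,
  [/\ c ^+ 2 + s ^+ 2 = 1, 0 <= c <= 1, 0 <= s, 1 - c <= 3^-1 ^+ k &
    forall d (T : measurableType d) (Q : {measure set T -> \bar R}) (h : nat -> T -> R),
      gaussian_sequence Q h ->
      (rotation_increment Q h 0 1 <= (4 ^+ k)%:E * rotation_increment Q h c s)%E].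
Proof.
elim: k => [|k [c [s [cs /andP[c0 c1] s0 ck IH]]]].
  exists 0, 1; rewrite !lexx ler01 expr0 subr0 lexx; split => //; first by ring.
  by move=> *; rewrite mul1e.
exists (Num.sqrt ((1 + c) / 2)), (Num.sqrt ((1 - c) / 2)).
set c' := Num.sqrt ((1 + c) / 2); set s' := Num.sqrt ((1 - c) / 2).
have c'0 : 0 <= c' by exact: sqrtr_ge0.
have s'0 : 0 <= s' by exact: sqrtr_ge0.
have c'2 : c' ^+ 2 = (1 + c) / 2 by rewrite sqr_sqrtr// divr_ge0// addr_ge0.
have s'2 : s' ^+ 2 = (1 - c) / 2 by rewrite sqr_sqrtr// divr_ge0// subr_ge0.
have c'1 : c' <= 1 by rewrite -(@ler_pXn2r _ 2)// ?nnegrE// expr1n c'2; lra.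
(* This makes [1 - c = 2 * (1 - c') * (1 + c')] at least [3 * (1 - c')]. *)
have c'h : 2^-1 <= c' by rewrite -(@ler_pXn2r _ 2)// ?nnegrE// c'2; lra.
split => //.
- by rewrite c'2 s'2; field.
- by rewrite c'0.
- apply: (@le_trans _ _ (3^-1 * (1 - c))); last by rewrite exprS ler_wpM2l.
  have -> : 1 - c = 2 * (1 - c') * (1 + c') by rewrite -(mulrA 2) mulrC; lra.
  have : 0 <= 1 - c' by lra.
  nra.
- move=> d T Q h hQ; apply: (le_trans (IH _ _ _ _ hQ)).
  have <- : 2 * c' ^+ 2 - 1 = c by rewrite c'2; field.
  have <- : 2 * c' * s' = s.
    apply/eqP; rewrite -(@eqrXn2 _ 2)// ?mulr_ge0// !exprMn c'2 s'2.
    by apply/eqP; rewrite -[s ^+ 2](addKr (c ^+ 2)) cs; field.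
  rewrite (exprSr 4) EFinM -muleA lee_wpmul2l ?lee_fin ?exprn_ge0//.
  by apply: rotation_increment_double => //; rewrite c'2 s'2; field.
Qed.

End RotationIncrement.

(** * Upper and lower bounds for the rotation increment *)

Section LowerTail.
Variables (R : realType) (X : normedModType R).
Variables (d : measure_display) (T : measurableType d) (P : probability T R).
Variable g : nat -> T -> R.
Hypothesis gP : gaussian_sequence P g.

Lemma gaussian_second_moment_ord n (c : 'I_n -> R) :
  (\int[P]_t ((\sum_(i < n) c i * g i t) ^+ 2)%:E = (\sum_(i < n) c i ^+ 2)%:E)%E.
Proof.
pose c' (j : nat) : R := if insub j is Some i then c i else 0.
have c'E (i : 'I_n) : c' i = c i by rewrite /c' valK.
have := gaussian_second_moment n c' gP.
under eq_bigr do rewrite c'E.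
by move=> <-; apply: eq_integral => t _; under [in RHS]eq_bigr do rewrite c'E.
Qed.

Variables (N : nat) (w : 'I_N -> X).
Hypothesis w_contr : forall c : 'I_N -> R,
  `|\sum_(k < N) c k *: w k| <= Num.sqrt (\sum_(k < N) c k ^+ 2).

Let Z := gaussian_vector w g 0.

Let mZ : measurable_fun setT (fun t => `|Z t|).
Proof. exact: (@measurable_norm_gaussian_vector _ _ _ _ _ gP _ _ w 0). Qed.

Let juxtapose0 z : gaussian_vector w (juxtapose g N) 0 z = Z z.1.
Proof. by apply: eq_bigr => k _; rewrite /juxtapose !add0n ltn_ord. Qed.

Let juxtaposeN z : gaussian_vector w (juxtapose g N) N z = Z z.2.
Proof.
apply: eq_bigr => k _; rewrite /juxtapose add0n addKn.
by rewrite (_ : (N + k < N)%N = false)// ltnNge leq_addr.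
Qed.

(** The functional norming [z], applied to [c *: z - s *: Z t], bounds the drop by the positive part
    of [(1 - c) * |z| + s * G], where [G] is the value of the functional at [Z t]. *)
Let norm_drop_bound (c s : R) (z : X) : 0 <= c <= 1 ->
  exists2 a : 'I_N -> R, \sum_(k < N) a k ^+ 2 <= 1 & forall t,
    norm_drop z (c *: z - s *: Z t) <=
      2 * (1 - c) ^+ 2 * `|z| ^+ 2 + 2 * s ^+ 2 * (\sum_(k < N) a k * g k t) ^+ 2.
Proof.
move=> /andP[c0 c1]; have [a Ha] := norming_coefficients w z.
exists a => [|t].
  pose S := \sum_(k < N) a k ^+ 2.
  (* The functional is tested on the combination with its own coefficients: domination by the norm
     and [w_contr] give [S <= sqrt S], hence [S <= 1]. *)
  have SS : S <= Num.sqrt S.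
    have := Ha 0 a; rewrite mul0r scale0r !add0r => H.
    exact: le_trans H (w_contr a).
  rewrite -/S.
  have S0 : 0 <= S by apply: sumr_ge0 => k _; exact: sqr_ge0.
  have := sqr_sqrtr S0; have := sqrtr_ge0 S; nra.
set G := \sum_(k < N) a k * g k t.
have : c * `|z| - s * G <= `|c *: z - s *: Z t|.
  have := Ha c (fun k => - s * g k t).
  rewrite (_ : \sum_(k < N) _ * a k = - s * G); last first.
    by rewrite /G mulr_sumr; apply: eq_bigr => k _; rewrite -mulrA (mulrC (g k t)).
  rewrite (_ : \sum_(k < N) _ *: w k = - s *: Z t); last first.
    by rewrite /Z /gaussian_vector scaler_sumr; apply: eq_bigr => k _; rewrite scalerA add0n.
  by rewrite scaleNr mulNr.
rewrite /norm_drop; move: `|c *: z - s *: Z t| => r Hr.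
have n0 := normr_ge0 z.
apply: (@le_trans _ _ (((1 - c) * `|z| + s * G) ^+ 2)).
  have [H|H] := leP 0 (`|z| - r).
    have : `|z| - r <= (1 - c) * `|z| + s * G by lra.
    by move=> H2; rewrite ler_pXn2r ?nnegrE//; exact: le_trans H H2.
  by rewrite expr0n sqr_ge0.
rewrite -subr_ge0 (_ : _ - _ = ((1 - c) * `|z| - s * G) ^+ 2) ?sqr_ge0//.
by ring.
Qed.

(** Fubini's theorem with the first copy fixed: the norming functional varies with it, but the
    variance bound 1 does not. The term in [s] is therefore free of the second moment of [Z]. *)
Lemma rotation_increment_le (c s : R) : 0 <= c <= 1 ->
  (rotation_increment w (P \x P) (juxtapose g N) c s <=
   (2 * (1 - c) ^+ 2)%:E * \int[P]_t (`|Z t| ^+ 2)%:E + (2 * s ^+ 2)%:E)%E.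
Proof.
move=> c01.
have mf : measurable_fun setT (fun z => norm_drop (gaussian_vector w (juxtapose g N) 0 z)
    (c *: gaussian_vector w (juxtapose g N) 0 z - s *: gaussian_vector w (juxtapose g N) N z)).
  have [mj _] := gaussian_sequence_juxtapose gP N.
  under eq_fun do rewrite gaussian_vector_comb.
  by apply: measurable_norm_drop => // k; apply: measurable_funB; exact: measurable_funM.
pose f z := (norm_drop (gaussian_vector w (juxtapose g N) 0 z)
  (c *: gaussian_vector w (juxtapose g N) 0 z
   - s *: gaussian_vector w (juxtapose g N) N z))%:E.
have emf : measurable_fun setT f by exact/measurable_EFinP.
have f0 z : (0 <= f z)%E by rewrite lee_fin norm_drop_ge0.
have fE : fubini_F P f = fun x => (\int[P]_y (norm_drop (Z x) (c *: Z x - s *: Z y))%:E)%E.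
  by apply/funext => x; apply: eq_integral => y _; rewrite /f juxtapose0 juxtaposeN.
have mint := measurable_fun_fubini_tonelli_F (m2 := P) f emf f0.
rewrite /rotation_increment (fubini_tonelli1 (m1 := P) (m2 := P) f emf f0) fE.
rewrite fE in mint.
have mZ2 : measurable_fun setT (fun t => `|Z t| ^+ 2) by exact: measurable_funX.
have k0 : 0 <= 2 * (1 - c) ^+ 2 :> R by rewrite mulr_ge0// sqr_ge0.
have l0 : 0 <= 2 * s ^+ 2 :> R by rewrite mulr_ge0// sqr_ge0.
apply: (@le_trans _ _ (\int[P]_x (2 * (1 - c) ^+ 2 * `|Z x| ^+ 2 + 2 * s ^+ 2)%:E)%E).
  apply: ge0_le_integral => //.
  - by move=> x _; apply: integral_ge0 => y _; rewrite lee_fin norm_drop_ge0.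
  - apply/measurable_EFinP; apply: measurable_funD => //; exact: measurable_funM.
  - move=> x _; have [a a1 Ha] := norm_drop_bound s (Z x) c01.
    have mG : measurable_fun setT (fun t => (\sum_(k < N) a k * g k t) ^+ 2).
      apply: measurable_funX; apply: measurable_sum => k.
      by apply: measurable_funM => //; exact: gP.1.
    apply: (@le_trans _ _ (\int[P]_y (2 * (1 - c) ^+ 2 * `|Z x| ^+ 2 +
        2 * s ^+ 2 * (\sum_(k < N) a k * g k y) ^+ 2)%:E)%E).
      apply: le_integral_EFin => //; last by move=> t; exact: norm_drop_ge0.
      - have := measurable_fun_pair2 x mf.
        by under eq_fun do rewrite juxtapose0 juxtaposeN /=.
      - by apply: measurable_funD => //; exact: measurable_funM.
    rewrite integralD_EFin//; last 3 first.
    - exact: measurable_funM.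
    - by move=> t; rewrite mulr_ge0// sqr_ge0.
    - by move=> t; rewrite mulr_ge0// sqr_ge0.
    rewrite integral_cst//= probability_setT mule1 integralZ_EFin//; last first.
      by move=> t; exact: sqr_ge0.
    rewrite gaussian_second_moment_ord -EFinM -EFinD lee_fin lerD2l.
    by rewrite -[leRHS]mulr1 ler_wpM2l.
rewrite integralD_EFin//; last 2 first.
- exact: measurable_funM.
- by move=> x; rewrite mulr_ge0// sqr_ge0.
rewrite integralZ_EFin//.
by rewrite integral_cst//= probability_setT mule1.
Qed.

End LowerTail.

Section LowerTailBound.
Variables (R : realType) (X : normedModType R).
Variables (d : measure_display) (T : measurableType d) (P : probability T R).
Variable g : nat -> T -> R.
Hypothesis gP : gaussian_sequence P g.

Section FixedVectors.
Variables (N : nat) (w : 'I_N -> X).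

Let Z := gaussian_vector w g 0.

Let mZ : measurable_fun setT (fun t => `|Z t|).
Proof. exact: (@measurable_norm_gaussian_vector _ _ _ _ _ gP _ _ w 0). Qed.

Lemma measurable_norm_lt (a : R) : measurable_fun setT (fun t => (`|Z t| < a)%R%:R : R).
Proof.
rewrite (_ : (fun t => _) = fun t => if `|Z t| < a then 1 else 0); last first.
  by apply/funext => t; case: ifP.
by apply: measurable_fun_ifT => //; exact: measurable_fun_ltr.
Qed.

Let mexc (a : R) : measurable_fun setT (fun t => Num.max 0 (`|Z t| - a) ^+ 2).
Proof.
by apply: measurable_funX; apply: measurable_maxr => //; exact: measurable_funB.
Qed.

(** When the second copy has norm below [a], the drop from the first is at least its excess over
    [a]; by independence the integral factors. *)
Lemma rotation_increment_ge (a : R) :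
  (\int[P]_t ((`|Z t| < a)%R%:R)%:E * \int[P]_t (Num.max 0 (`|Z t| - a) ^+ 2)%R%:E <=
   rotation_increment w (P \x P) (juxtapose g N) 0 1)%E.
Proof.
pose f (z : T * T) : \bar R := ((`|Z z.2| < a)%R%:R * Num.max 0 (`|Z z.1| - a) ^+ 2)%:E.
have mf : measurable_fun setT f.
  apply/measurable_EFinP; apply: measurable_funM.
    exact: (measurableT_comp (measurable_norm_lt a)).
  exact: (measurableT_comp (mexc a)).
have f0 z : (0 <= f z)%E by rewrite lee_fin mulr_ge0// sqr_ge0.
have fE : (\int[P \x P]_z f z =
    \int[P]_t ((`|Z t| < a)%R%:R)%:E * \int[P]_t (Num.max 0 (`|Z t| - a) ^+ 2)%R%:E)%E.
  rewrite (fubini_tonelli1 (m1 := P) (m2 := P) f mf f0) /fubini_F.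
  under eq_integral => x _.
    rewrite /f /=; under eq_integral do rewrite mulrC.
    rewrite integralZ_EFin//; [|exact: measurable_norm_lt|exact: sqr_ge0].
    over.
  rewrite /= ge0_integralZr//.
  - by rewrite muleC.
  - by apply/measurable_EFinP; exact: mexc.
  - by move=> x _; rewrite lee_fin sqr_ge0.
  - by apply: integral_ge0 => x _; rewrite lee_fin.
rewrite -fE; apply: ge0_le_integral => //.
  have [mj _] := gaussian_sequence_juxtapose gP N.
  apply/measurable_EFinP; under eq_fun do rewrite gaussian_vector_comb.
  by apply: measurable_norm_drop => // k; apply: measurable_funB; exact: measurable_funM.
move=> z _; rewrite lee_fin scale0r sub0r scale1r /norm_drop normrN.
have -> : gaussian_vector w (juxtapose g N) 0 z = Z z.1.
  by apply: eq_bigr => k _; rewrite /juxtapose !add0n ltn_ord.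
have -> : gaussian_vector w (juxtapose g N) N z = Z z.2.
  apply: eq_bigr => k _; rewrite /juxtapose add0n addKn.
  by rewrite (_ : (N + k < N)%N = false)// ltnNge leq_addr.
case: ltP => [za|_]; last by rewrite mul0r sqr_ge0.
have m0 (x : R) : 0 <= Num.max 0 x by rewrite le_max lexx.
rewrite mul1r ler_pXn2r ?nnegrE ?m0// ge_max m0/=.
by rewrite le_max lerD2l lerN2 (ltW za) orbT.
Qed.

(** Values up to [a = (1 - e) * M] cannot account for the second moment: with [j] the excess, [(a +
    j) ^+ 2 <= (1 + e) * a ^+ 2 + (1 + e^-1) * j ^+ 2], and [(1 + e) * a ^+ 2 <= (1 - e) * M ^+ 2]
    leaves [e * M ^+ 2] for the second term. *)
Lemma gaussian_norm_excess (e M : R) : 0 < e < 1 -> 0 <= M ->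
  (\int[P]_t (`|Z t| ^+ 2)%:E = (M ^+ 2)%:E)%E ->
  ((e ^+ 2 / 2 * M ^+ 2)%:E <= \int[P]_t (Num.max 0 (`|Z t| - (1 - e) * M) ^+ 2)%R%:E)%E.
Proof.
move=> /andP[e0 e1] M0 ME; set a := (1 - e) * M.
have pointwise t : `|Z t| ^+ 2 <= (1 + e) * a ^+ 2 +
    (1 + e^-1) * Num.max 0 (`|Z t| - a) ^+ 2.
  have a0 : 0 <= a by rewrite mulr_ge0// subr_ge0 ltW.
  have : `|Z t| <= a + Num.max 0 (`|Z t| - a) by rewrite -lerBlDl le_max lexx orbT.
  have : 0 <= Num.max 0 (`|Z t| - a) by rewrite le_max lexx.
  move: (Num.max _ _) (normr_ge0 (Z t)) => j; move: `|Z t| => r r0 j0 raj.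
  apply: (@le_trans _ _ ((a + j) ^+ 2)); first by rewrite ler_pXn2r ?nnegrE// addr_ge0.
  rewrite -subr_ge0 (_ : _ - _ = e^-1 * (e * a - j) ^+ 2); last by field; rewrite gt_eqF.
  by rewrite mulr_ge0 ?invr_ge0 ?(ltW e0)// sqr_ge0.
set I := (\int[P]_t _)%E.
have I0 : (0 <= I)%E by apply: integral_ge0 => t _; rewrite lee_fin sqr_ge0.
have key : ((M ^+ 2)%:E <= ((1 + e) * a ^+ 2)%:E + (1 + e^-1)%:E * I)%E.
  rewrite -ME; apply: (@le_trans _ _ (\int[P]_t ((1 + e) * a ^+ 2 +
     (1 + e^-1) * Num.max 0 (`|Z t| - a) ^+ 2)%R%:E)%E).
    apply: le_integral_EFin => //; first exact: measurable_funX.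
    by apply: measurable_funD => //; apply: measurable_funM => //; exact: mexc.
  have e10 : 0 <= 1 + e^-1 by rewrite addr_ge0// invr_ge0 ltW.
  rewrite integralD_EFin//.
  - by rewrite integral_cst//= probability_setT mule1 integralZ_EFin// => t; exact: sqr_ge0.
  - by apply: measurable_funM => //; exact: mexc.
  - by move=> _; apply: mulr_ge0; rewrite ?sqr_ge0 ?addr_ge0 ?(ltW e0).
  - by move=> t; apply: mulr_ge0; rewrite ?sqr_ge0.
case: I I0 key => [r| |] //; last by move=> *; rewrite leey.
move=> r0 H; rewrite lee_fin; rewrite lee_fin in r0; rewrite -EFinM -EFinD lee_fin in H.
have : M ^+ 2 * e <= (1 + e^-1) * r.
  have : (1 + e) * a ^+ 2 <= (1 - e) * M ^+ 2.
    rewrite /a exprMn mulrA ler_wpM2r ?sqr_ge0//; nra.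
  nra.
have -> : (1 + e^-1) * r = ((1 + e) * r) / e by field; rewrite gt_eqF.
rewrite ler_pdivlMr// => H2; have := sqr_ge0 M; nra.
Qed.

End FixedVectors.

(** After [k] halvings the increment costs a factor [4 ^ k], but [(1 - c) ^+ 2 <= 9 ^ -k]: the part
    proportional to [M ^+ 2] is of order [(4/9) ^ k]. The rest, at most [2 * 4 ^ k], is absorbed by
    a large [M]. The threshold [K] is uniform in [N] and [w]. *)
Lemma gaussian_norm_lower_tail (e eta : R) : 0 < e < 1 -> 0 < eta ->
  exists2 K : R, 0 < K & forall N (w : 'I_N -> X) (M : R),
    (forall c : 'I_N -> R, `|\sum_(k < N) c k *: w k| <= Num.sqrt (\sum_(k < N) c k ^+ 2)) ->
    (\int[P]_t (`|gaussian_vector w g 0 t| ^+ 2)%:E = (M ^+ 2)%:E)%E -> K <= M ->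
    (\int[P]_t ((`|gaussian_vector w g 0 t| < (1 - e) * M)%R%:R)%:E <= eta%:E)%E.
Proof.
move=> e01 eta0; have /andP[e0 e1] := e01.
(* Each of the two error terms will be at most [r * M ^+ 2], and [2 * r] is [eta] times the factor
   [e ^+ 2 / 2] of [gaussian_norm_excess]. *)
pose r : R := eta * e ^+ 2 / 4.
have r0 : 0 < r by rewrite divr_gt0// mulr_gt0// exprn_gt0.
have [k kr] : exists k, 2 * (4 / 9) ^+ k <= r.
  have c : `|4 / 9 : R| < 1 by rewrite ger0_norm; lra.
  have r20 : 0 < r / 2 by rewrite divr_gt0.
  have /cvgrPdist_lt/(_ _ r20) [k _ Hk] := cvg_expr c.
  exists k; have := Hk k (leqnn k); rewrite /= sub0r normrN ger0_norm; last first.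
    by rewrite exprn_ge0//; lra.
  lra.
exists (Num.sqrt (2 * 4 ^+ k / r)); first by rewrite sqrtr_gt0 divr_gt0// mulr_gt0// exprn_gt0.
move=> N w M w_contr ME KM.
have M0 : 0 < M.
  by apply: lt_le_trans KM; rewrite sqrtr_gt0 divr_gt0// mulr_gt0// exprn_gt0.
have M2 : 2 * 4 ^+ k <= r * M ^+ 2.
  rewrite -ler_pdivrMl// mulrC -[leLHS]sqr_sqrtr; last first.
    by rewrite divr_ge0 ?(ltW r0)// mulr_ge0// exprn_ge0.
  by rewrite ler_pXn2r// nnegrE ?sqrtr_ge0 ?(ltW M0).
have [c [s [cs c01 s0 c1 H]]] := rotation_increment_halved w k.
have /andP[c0 c1'] := c01.
have := H _ _ _ _ (gaussian_sequence_juxtapose gP N).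
have := rotation_increment_le gP w_contr s c01; rewrite ME => H1 H2.
have := gaussian_norm_excess e01 (ltW M0) ME.
have := rotation_increment_ge w ((1 - e) * M).
set p := (\int[P]_t _)%E; set I := (\int[P]_t _)%E => H3 H4.
have p0 : (0 <= p)%E by apply: integral_ge0 => t _; rewrite lee_fin.
have : (p * (e ^+ 2 / 2 * M ^+ 2)%:E <= (4 ^+ k * (2 * (1 - c) ^+ 2 * M ^+ 2 + 2 * s ^+ 2))%:E)%E.
  apply: (le_trans (lee_wpmul2l p0 H4)); apply: (le_trans H3); apply: (le_trans H2).
  by rewrite EFinM lee_wpmul2l ?lee_fin ?exprn_ge0// EFinD EFinM.
have pfin : p \is a fin_num.
  rewrite ge0_fin_numE// (@le_lt_trans _ _ (\int[P]_t 1%:E)%E)//.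
    apply: le_integral_EFin => //; first exact: measurable_norm_lt.
    by move=> t; rewrite lern1 leq_b1.
  by rewrite integral_cst//= probability_setT mule1 ltry.
rewrite -(fineK pfin) -EFinM !lee_fin => H5.
have s1 : s ^+ 2 <= 1 by rewrite -cs lerDr sqr_ge0.
have q2 : (1 - c) ^+ 2 <= (3^-1 ^+ k) ^+ 2.
  by rewrite ler_pXn2r// nnegrE ?subr_ge0// exprn_ge0// invr_ge0.
have q3 : 4 ^+ k * (2 * (1 - c) ^+ 2) <= r.
  apply: le_trans kr; rewrite mulrCA ler_wpM2l//.
  apply: (@le_trans _ _ (4 ^+ k * (3^-1 ^+ k) ^+ 2)); first by rewrite ler_wpM2l// exprn_ge0.
  by rewrite -exprM mulnC exprM -exprMn (_ : 4 * 3^-1 ^+ 2 = 4 / 9)//; field.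
have H6 : fine p * (e ^+ 2 / 2 * M ^+ 2) <= r * M ^+ 2 + r * M ^+ 2.
  apply: (le_trans H5); rewrite mulrDr mulrA; apply: lerD.
    by rewrite ler_wpM2r ?sqr_ge0.
  apply: le_trans M2; rewrite mulrCA -[leRHS]mulr1 -mulrA ler_wpM2l//.
  by rewrite ler_wpM2l// exprn_ge0.
have W : 0 < e ^+ 2 / 2 * M ^+ 2 by rewrite mulr_gt0 ?divr_gt0 ?exprn_gt0.
rewrite -(ler_pM2r W) (le_trans H6)// /r le_eqVlt; apply/orP; left; apply/eqP.
by field.
Qed.

End LowerTailBound.

Lemma exists_le_integral (R : realType) d (T : measurableType d) (P : probability T R)
    (f : T -> \bar R) (a : R) : measurable_fun setT f -> (forall t, 0 <= f t)%E ->
  0 <= a -> (\int[P]_t f t < a%:E)%E -> exists t, (f t <= a%:E)%E.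
Proof.
move=> mf f0 a0 fa; apply: contrapT => H.
suff : (a%:E <= \int[P]_t f t)%E by rewrite leNgt fa.
have -> : a%:E = (\int[P]_t a%:E)%E by rewrite integral_cst//= probability_setT mule1.
apply: ge0_le_integral => // t _; rewrite leNgt; apply/negP => /ltW fta; apply: H; by exists t.
Qed.

(** * Almost Euclidean separated systems *)

Section Selection.
Variables (R : realType) (X : normedModType R).
Variables (d : measure_display) (T : measurableType d) (P : probability T R).
Variable g : nat -> T -> R.
Hypothesis gP : gaussian_sequence P g.

Lemma large_gaussian_norm (C K : R) : infinite_dim X -> 0 < C ->
  (forall n (x : 'I_n -> X), ((\sum_(i < n) `|x i| ^+ 2)%:E <=
     (C ^+ 2)%:E * \int[P]_t (`|gaussian_vector x g 0 t| ^+ 2)%:E)%E) ->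
  exists m (w : 'I_m -> X) (M : R), [/\
    (forall c : 'I_m -> R, `|\sum_(k < m) c k *: w k| <= Num.sqrt (\sum_(k < m) c k ^+ 2)),
    (\int[P]_t (`|gaussian_vector w g 0 t| ^+ 2)%:E = (M ^+ 2)%:E)%E, 0 < M & K <= M].
Proof.
move=> Xinf C0 HC.
(* For [m >= B] vectors of norm at least 1/4, the cotype inequality gives [B / 16 <= C ^+ 2 * J],
   that is [|K| + 1 <= sqrt J]. The 1 makes [M] positive. *)
pose B := (4 * C * (`|K| + 1)) ^+ 2.
pose m := Num.bound B.
have Bm : B <= m%:R by apply: ltW; apply: archi_boundP; exact: sqr_ge0.
have [w [w4 w_contr]] := dvoretzky_rogers m Xinf.
have J0 : (0 <= \int[P]_t (`|gaussian_vector w g 0 t| ^+ 2)%:E)%E.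
  by apply: integral_ge0 => t _; exact: sqr_ge0.
have Jfin : (\int[P]_t (`|gaussian_vector w g 0 t| ^+ 2)%:E)%E \is a fin_num.
  by rewrite ge0_fin_numE//; exact: (gaussian_vector_sqr_lty gP w 0).
have wJ := HC _ w; have [J JE] : exists J, (\int[P]_t (`|gaussian_vector w g 0 t| ^+ 2)%:E = J%:E)%E.
  by exists (fine (\int[P]_t (`|gaussian_vector w g 0 t| ^+ 2)%:E)%E); rewrite fineK.
rewrite JE lee_fin in J0; rewrite JE -EFinM lee_fin in wJ.
have ME : J = Num.sqrt J ^+ 2 by rewrite sqr_sqrtr.
have KJ : `|K| + 1 <= Num.sqrt J.
  rewrite -(@ler_pXn2r _ 2)// ?nnegrE ?addr_ge0 ?sqrtr_ge0// -ME.
  have : B / 16 <= C ^+ 2 * J.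
    apply: le_trans wJ; apply: (@le_trans _ _ (m%:R * 4^-1 ^+ 2)).
      by rewrite (_ : 4^-1 ^+ 2 = 16^-1) ?ler_wpM2r//; field.
    rewrite -[m%:R](_ : \sum_(i < m) 1 = _); last by rewrite sumr_const card_ord.
    rewrite mulr_suml; apply: ler_sum => i _; rewrite mul1r.
    by rewrite ler_pXn2r// ?nnegrE ?invr_ge0.
  rewrite /B (_ : _ / 16 = C ^+ 2 * (`|K| + 1) ^+ 2); last by field.
  by rewrite ler_pM2l// exprn_gt0.
exists m, w, (Num.sqrt J); split => //.
- by rewrite JE -ME.
- by apply: lt_le_trans KJ; rewrite ltr_wpDl.
- by apply: le_trans KJ; rewrite (le_trans (ler_norm K))// lerDl.
Qed.

(** The vectors are [Z i u / M] at a point [u] where one function [Phi], collecting all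
    requirements, is at most [1 + e]. The norm bound depends on [n] and [e] only, which allows the
    finite family [c] to be chosen before the vectors. *)
Lemma euclidean_selection (C : R) n (t : nat -> R) (e : R) (I : finType) (c : I -> nat -> R) :
  infinite_dim X -> 0 < C ->
  (forall n (x : 'I_n -> X), ((\sum_(i < n) `|x i| ^+ 2)%:E <=
     (C ^+ 2)%:E * \int[P]_t (`|gaussian_vector x g 0 t| ^+ 2)%:E)%E) ->
  0 < \sum_(i < n.+1) t i ^+ 2 -> 0 < e < 1 ->
  exists x : nat -> X, [/\
    (\int[P]_u (`|\sum_(i < n.+1) g i u *: (t i *: x i)| ^+ 2)%:E <=
      ((1 + e) * \sum_(i < n.+1) t i ^+ 2)%:E)%E,
    (forall i, (i < n.+1)%N -> `|x i| ^+ 2 <= 8 * n.+1%:R / e) &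
    forall a, (1 - e) * Num.sqrt (\sum_(i < n.+1) c a i ^+ 2) <=
      `|\sum_(i < n.+1) c a i *: x i|].
Proof.
move=> Xinf C0 HC S0 e01; have /andP[e0 e1] := e01.
set S := \sum_(i < n.+1) t i ^+ 2 in S0 *.
pose eta := e / (4 * (#|I|%:R + 1)).
have I1 : 0 < #|I|%:R + 1 :> R by rewrite ltr_wpDl.
have eta0 : 0 < eta by rewrite divr_gt0// mulr_gt0.
have [K K0 HK] := gaussian_norm_lower_tail X gP e01 eta0.
have [m [w [M [w_contr ME M0 KM]]]] := large_gaussian_norm K Xinf C0 HC.
pose Z i := gaussian_vector w g (i * m).
pose delta := e / (4 * n.+1%:R).
have delta0 : 0 < delta by rewrite divr_gt0// mulr_gt0.
pose V a u := \sum_(i < n.+1) c a i *: Z i u.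
pose rho a := (1 - e) * (Num.sqrt (\sum_(i < n.+1) c a i ^+ 2) * M).
(* The mean of [G] is at most [e / 4 + e / 2]. At the selected point [G <= 1 + e < 2], so the weight
   2 excludes every bad event and the first term bounds each [|Z i u|]. *)
pose G u : R := delta / M ^+ 2 * (\sum_(i < n.+1) `|Z i u| ^+ 2) +
  2 * \sum_(a : I) ((`|V a u| < rho a)%R%:R).
(* [z.1] selects the vectors and [z.2] drives their Gaussian sum. For fixed [z.2], stability
   integrates [z.1] to [M ^+ 2] times a sum of squares, whose mean over [z.2] is [S]. *)
pose f (z : T * T) : \bar R := (`|\sum_(i < n.+1) (g i z.2 * t i) *: Z i z.1| ^+ 2)%:E.
pose H u := (\int[P]_u' f (u, u'))%E.
have combE (b : nat -> R) u : \sum_(i < n.+1) b i *: Z i u =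
    \sum_(k < m) (\sum_(i < n.+1) b i * g (i * m + k)%N u) *: w k.
  rewrite /Z /gaussian_vector; under eq_bigr do rewrite scaler_sumr.
  rewrite exchange_big; apply: eq_bigr => k _; rewrite scaler_suml.
  by apply: eq_bigr => i _; rewrite scalerA.
have mZ i : measurable_fun setT (fun u => `|Z i u|).
  exact: (@measurable_norm_gaussian_vector _ _ _ _ _ gP _ _ w (i * m)).
have mV a : measurable_fun setT (fun u => `|V a u|).
  under eq_fun do rewrite /V combE; apply: measurable_norm_lincomb => k.
  apply: measurable_sum => i; apply: measurable_funM => //; exact: gP.1.
have mI a : measurable_fun setT (fun u => ((`|V a u| < rho a)%R%:R) : R).
  rewrite (_ : (fun u => _) = fun u => if `|V a u| < rho a then 1 else 0); last first.
    by apply/funext => u; case: ifP.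
  by apply: measurable_fun_ifT => //; exact: measurable_fun_ltr.
have mG : measurable_fun setT G.
  apply: measurable_funD; apply: measurable_funM => //; apply: measurable_sum => i //.
  exact: measurable_funX.
have mf : measurable_fun setT f.
  apply/measurable_EFinP; apply: measurable_funX.
  under eq_fun => z do rewrite (combE (fun i => g i z.2 * t i)).
  apply: measurable_norm_lincomb => k; apply: measurable_sum => i.
  apply: measurable_funM; last exact: (measurableT_comp (gP.1 _)).
  by apply: measurable_funM => //; exact: (measurableT_comp (gP.1 _)).
have f0 z : (0 <= f z)%E by rewrite lee_fin sqr_ge0.
have mH : measurable_fun setT H := measurable_fun_fubini_tonelli_F (m2 := P) f mf f0.
have H0 u : (0 <= H u)%E by exact: integral_ge0.
have msq : measurable_fun setT (fun r : R => (r ^+ 2)%:E).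
  by apply/measurable_EFinP; exact: measurable_funX.
have sq0 (r : R) : (0 <= (r ^+ 2)%:E)%E by rewrite lee_fin sqr_ge0.
have sq_stable (k : nat) (b : nat -> R) :
    (\int[P]_u (`|\sum_(i < k.+1) b i *: Z i u| ^+ 2)%:E =
     ((\sum_(i < k.+1) b i ^+ 2) * M ^+ 2)%:E)%E.
  have Q0 : 0 <= \sum_(i < k.+1) b i ^+ 2 by apply: sumr_ge0 => i _; exact: sqr_ge0.
  rewrite (gaussian_vector_stable w k b msq sq0 gP).
  under eq_integral do rewrite exprMn sqr_sqrtr//.
  rewrite integralZ_EFin//; first by rewrite ME EFinM.
  by apply: measurable_funX; exact: (mZ 0%N).
have HE : (\int[P]_u H u = (S * M ^+ 2)%:E)%E.
  rewrite /H (fubini_tonelli (m1 := P) (m2 := P) f mf f0).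
  under eq_integral => u' _ do rewrite /f /= (sq_stable n (fun i => g i u' * t i)) mulrC.
  rewrite integralZ_EFin//; last 3 first.
  - apply: measurable_sum => i; apply: measurable_funX; apply: measurable_funM => //.
    exact: gP.1.
  - by move=> u; apply: sumr_ge0 => i _; exact: sqr_ge0.
  - exact: sqr_ge0.
  rewrite (mulrC S) [RHS]EFinM; congr (_ * _)%E.
  under eq_integral do under eq_bigr do rewrite exprMn mulrC.
  rewrite integral_sum_EFin; last 2 first.
  - move=> i; apply: measurable_funM => //; apply: measurable_funX; exact: gP.1.
  - by move=> i u; rewrite mulr_ge0// sqr_ge0.
  rewrite /S -sumEFin; apply: eq_bigr => i _.
  rewrite integralZ_EFin ?sqr_ge0//.
  - by rewrite (gaussian_coord_second_moment gP) mule1.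
  - by apply: measurable_funX; exact: gP.1.
  - by move=> u; exact: sqr_ge0.
have ZE i : (\int[P]_u (`|Z i u| ^+ 2)%:E = (M ^+ 2)%:E)%E.
  have := sq_stable i (fun j => (j == i)%:R).
  rewrite big_ord_recr /= big1 => [|j _]; last by rewrite ltn_eqF// expr0n.
  rewrite eqxx expr1n add0r mul1r => <-; apply: eq_integral => u _.
  rewrite big_ord_recr /= big1 => [|j _]; last by rewrite ltn_eqF// scale0r.
  by rewrite eqxx scale1r add0r.
have IE a : (\int[P]_u ((`|V a u| < rho a)%R%:R)%:E <= eta%:E)%E.
  pose F (r : R) : \bar R := ((r < rho a)%R%:R)%:E.
  have mF : measurable_fun setT F.
    apply/measurable_EFinP.
    rewrite (_ : (fun r => _) = fun r => if r < rho a then 1 else 0); last first.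
      by apply/funext => r; case: ifP.
    by apply: measurable_fun_ifT => //; exact: measurable_fun_ltr.
  have F0 r : (0 <= F r)%E by rewrite lee_fin.
  have := gaussian_vector_stable w n (c a) mF F0 gP; rewrite /F /V => ->.
  apply: le_trans (HK _ _ _ w_contr ME KM); apply: ge0_le_integral => //.
  - apply: (measurableT_comp mF); apply: measurable_funM => //; exact: (mZ 0%N).
  - by apply/measurable_EFinP; exact: (@measurable_norm_lt _ _ _ _ P g gP _ w).
  - move=> u _; rewrite lee_fin /rho mulrCA.
    set q := Num.sqrt _; have : 0 <= q by exact: sqrtr_ge0.
    rewrite le_eqVlt => /predU1P[<-|q0]; first by rewrite !mul0r ltxx.
    by rewrite ltr_pM2l.
have GE : (\int[P]_u (G u)%:E <= (e / 4 + e / 2)%:E)%E.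
  have mZ2 i : measurable_fun setT (fun u => `|Z i u| ^+ 2) by exact: measurable_funX.
  have dM : 0 <= delta / M ^+ 2 by rewrite divr_ge0 ?(ltW delta0)// sqr_ge0.
  rewrite /G integralD_EFin; last 4 first.
  - by apply: measurable_funM => //; exact: measurable_sum.
  - by apply: measurable_funM => //; exact: measurable_sum.
  - by move=> u; rewrite mulr_ge0// sumr_ge0// => i _; exact: sqr_ge0.
  - by move=> u; rewrite mulr_ge0// sumr_ge0.
  rewrite EFinD; apply: leeD.
    rewrite integralZ_EFin; last 3 first.
    - exact: measurable_sum.
    - by move=> u; rewrite sumr_ge0// => i _; exact: sqr_ge0.
    - by [].
    rewrite integral_sum_EFin//.
    under eq_bigr do rewrite ZE.
    rewrite sumEFin -EFinM lee_fin sumr_const card_ord -[M ^+ 2 *+ _]mulr_natr.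
    rewrite /delta le_eqVlt; apply/orP; left; apply/eqP.
    have : n.+1%:R != 0 :> R by rewrite pnatr_eq0.
    move: (n.+1%:R : R) => nn nn0; field.
    by rewrite nn0 gt_eqF.
  rewrite integralZ_EFin; last 3 first.
  - exact: measurable_sum.
  - by move=> u; rewrite sumr_ge0.
  - by [].
  rewrite integral_sum_EFin//.
  apply: (@le_trans _ _ (2%:E * (\sum_(a : I) eta%:E))%E).
    by rewrite lee_wpmul2l//; apply: lee_sum => a _; exact: IE.
  rewrite sumEFin -EFinM lee_fin sumr_const -[eta *+ _]mulr_natr /eta.
  have -> : 2 * (e / (4 * (#|I|%:R + 1)) * #|I|%:R) = (e / 2) * (#|I|%:R / (#|I|%:R + 1)).
    by field; rewrite gt_eqF.
  rewrite ler_piMr ?divr_ge0 ?(ltW e0)// ler_pdivrMr// mul1r lerDl//.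
pose Phi u := ((S * M ^+ 2)^-1%:E * H u + (G u)%:E)%E.
have SM : 0 < S * M ^+ 2 by rewrite mulr_gt0// exprn_gt0.
have G0 u : 0 <= G u.
  apply: addr_ge0; apply: mulr_ge0 => //; last exact: sumr_ge0.
    by rewrite divr_ge0 ?(ltW delta0)// sqr_ge0.
  by apply: sumr_ge0 => i _; exact: sqr_ge0.
have [u Hu] : exists u, (Phi u <= (1 + e)%:E)%E.
  apply: (exists_le_integral (P := P)).
  - apply: emeasurable_funD; last exact/measurable_EFinP.
    by apply: emeasurable_funM.
  - by move=> u; rewrite adde_ge0 ?mule_ge0// lee_fin ?invr_ge0 ?(ltW SM).
  - by rewrite addr_ge0// ltW.
  - rewrite ge0_integralD//; last 4 first.
    + by move=> u _; rewrite mule_ge0// lee_fin invr_ge0 ltW.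
    + exact: emeasurable_funM.
    + by move=> u _; rewrite lee_fin.
    + exact/measurable_EFinP.
    rewrite ge0_integralZl//; last by rewrite lee_fin invr_ge0 ltW.
    rewrite HE -EFinM mulVf ?gt_eqF//.
    apply: (@le_lt_trans _ _ (1%:E + (e / 4 + e / 2)%:E)%E); first by rewrite leeD2l.
    by rewrite -EFinD lte_fin; lra.
have SMV : 0 < (S * M ^+ 2)^-1 by rewrite invr_gt0.
have [h Hh] : exists h, H u = h%:E.
  move: Hu (H0 u); rewrite /Phi; case: (H u) => [h _ _| |//]; first by exists h.
  by rewrite gt0_muley ?lte_fin// addye.
have h0 : 0 <= h by have := H0 u; rewrite Hh lee_fin.
have hG : (S * M ^+ 2)^-1 * h + G u <= 1 + e by move: Hu; rewrite /Phi Hh -EFinM -EFinD lee_fin.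
have G1 : G u <= 1 + e by apply: le_trans hG; rewrite lerDr mulr_ge0// ltW.
have h1 : h <= (1 + e) * (S * M ^+ 2).
  by rewrite -ler_pdivrMr// mulrC (le_trans _ hG)// lerDl.
have MV : 0 < M^-1 by rewrite invr_gt0.
pose x i := M^-1 *: Z i u.
have xE (b : nat -> R) : \sum_(i < n.+1) b i *: x i = M^-1 *: \sum_(i < n.+1) b i *: Z i u.
  by rewrite scaler_sumr; apply: eq_bigr => i _; rewrite /x !scalerA mulrC.
have sum_ge (b : 'I_n.+1 -> R) (j : 'I_n.+1) : (forall i, 0 <= b i) -> b j <= \sum_(i < n.+1) b i.
  by move=> b0; rewrite (bigD1 j)//= lerDl sumr_ge0.
have dM : 0 <= delta / M ^+ 2 by apply: divr_ge0; [exact: ltW|exact: sqr_ge0].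
exists x; split.
- have E u' : ((`|\sum_(i < n.+1) g i u' *: (t i *: x i)| ^+ 2)%:E =
      (M^-1 ^+ 2)%:E * f (u, u'))%E.
    under eq_bigr do rewrite scalerA.
    by rewrite (xE (fun i => g i u' * t i)) normrZ (gtr0_norm MV) exprMn EFinM.
  under eq_integral do rewrite E.
  rewrite ge0_integralZl//; last first.
    exact: measurable_fun_pair2 mf.
  rewrite -/(H u) Hh -EFinM lee_fin.
  apply: (@le_trans _ _ (M^-1 ^+ 2 * ((1 + e) * (S * M ^+ 2)))).
    by rewrite ler_wpM2l// sqr_ge0.
  by rewrite le_eqVlt; apply/orP; left; apply/eqP; field; rewrite gt_eqF.
- move=> i ilt; rewrite /x normrZ (gtr0_norm MV) exprMn.
  have : delta / M ^+ 2 * `|Z i u| ^+ 2 <= 1 + e.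
    apply: le_trans G1; rewrite /G.
    apply: (@le_trans _ _ (delta / M ^+ 2 * (\sum_(i < n.+1) `|Z i u| ^+ 2))).
      rewrite ler_wpM2l//.
      by apply: (sum_ge (fun i => `|Z i u| ^+ 2) (Ordinal ilt)) => k; exact: sqr_ge0.
    by rewrite lerDl mulr_ge0// sumr_ge0.
  have -> : delta / M ^+ 2 * `|Z i u| ^+ 2 = delta * (M^-1 ^+ 2 * `|Z i u| ^+ 2).
    by rewrite exprVn -mulrA.
  rewrite -ler_pdivlMl// => /le_trans; apply.
  rewrite /delta invf_div.
  have : 0 < (n.+1%:R : R) by [].
  move: (n.+1%:R : R) => nn nn0.
  rewrite mulrAC ler_pM2r ?invr_gt0//; nra.
- move=> a; rewrite (xE (c a)) normrZ (gtr0_norm MV) ler_pdivlMl// leNgt; apply/negP => Va.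
  have : 2 <= G u; last by move=> G2; have := le_trans G2 G1; lra.
  rewrite /G; apply: (@le_trans _ _ (2 * \sum_a (`|V a u| < rho a)%R%:R)).
    rewrite -[leLHS]mulr1 ler_wpM2l// (bigD1 a)//=.
    have -> : `|V a u| < rho a by rewrite /rho mulrA mulrC.
    by rewrite lerDl sumr_ge0.
  rewrite lerDr mulr_ge0//.
  by apply: sumr_ge0 => i _; exact: sqr_ge0.
Qed.

End Selection.

Lemma grid_point (R : realType) (L : nat) (th : R) : 0 <= th <= 1 ->
  exists l : 'I_L.+2, `|th - l%:R / L.+1%:R| <= L.+1%:R^-1.
Proof.
move=> /andP[th0 th1]; have L0 : 0 < L.+1%:R :> R by [].
have tL0 : 0 <= th * L.+1%:R by rewrite mulr_ge0.
have /andP[l1 l2] := Num.Theory.truncn_itv tL0.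
set l := Num.truncn _ in l1 l2.
have lL : (l < L.+2)%N.
  rewrite ltnS -(ler_nat R) (le_trans l1)// -[leRHS]mul1r ler_wpM2r//.
exists (Ordinal lL) => /=; rewrite ger0_norm.
  rewrite -(@ler_pM2r _ L.+1%:R)// mulrBl divfK ?gt_eqF// mulVf ?gt_eqF//.
  by rewrite -natr1 in l2; lra.
by rewrite subr_ge0 ler_pdivrMr.
Qed.

(** * From a finite grid of combinations to all pairs of scalars *)

Section SeparatedSystem.
Variables (R : realType) (X : normedModType R).
Variables (d : measure_display) (T : measurableType d) (P : probability T R).
Variable g : nat -> T -> R.
Hypothesis gP : gaussian_sequence P g.

Lemma separated_system (C : R) n (t : nat -> R) (e : R) :
  infinite_dim X -> 0 < C ->
  (forall n (x : 'I_n -> X), ((\sum_(i < n) `|x i| ^+ 2)%:E <=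
     (C ^+ 2)%:E * \int[P]_t (`|gaussian_vector x g 0 t| ^+ 2)%:E)%E) ->
  0 < \sum_(i < n.+1) t i ^+ 2 -> 0 < e < 1 ->
  exists x : nat -> X, [/\
    (\int[P]_u (`|\sum_(i < n.+1) g i u *: (t i *: x i)| ^+ 2)%:E <=
      ((1 + e) * \sum_(i < n.+1) t i ^+ 2)%:E)%E,
    (forall i, (i < n.+1)%N -> 1 - e <= `|x i|) &
    forall i j, (i < n.+1)%N -> (j < n.+1)%N -> i != j ->
      forall p q, 0 <= p -> 0 <= q ->
      (1 - e) / Num.sqrt 2 * (p + q) <= `|p *: x i - q *: x j|].
Proof.
move=> Xinf C0 HC S0 /andP[e0 e1].
pose e' := e / 2; have e'01 : 0 < e' < 1 by rewrite /e'; apply/andP; split; lra.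
pose A := Num.sqrt (8 * n.+1%:R / e').
have s2 : 0 < Num.sqrt 2 :> R by rewrite sqrtr_gt0.
(* [A] bounds the norms of vectors that are still to be selected. With this mesh, moving [th] to the
   grid costs at most [e / 2] divided by [sqrt 2]; the other [e / 2] is [e']. *)
pose L := Num.bound (4 * Num.sqrt 2 * A / e).
have Lb : 4 * Num.sqrt 2 * A / e <= L.+1%:R.
  apply: ltW; apply: (lt_le_trans (archi_boundP _)); last by rewrite ler_nat.
  by rewrite divr_ge0 ?(ltW e0)// !mulr_ge0// sqrtr_ge0.
pose r (l : 'I_L.+2) : R := l%:R / L.+1%:R.
(* The coefficients of [r *: x i - (1 - r) *: x j]. The diagonal [i = j] with [r = 1] gives the
   lower bound on single norms, because the first test takes precedence. *)
pose c (a : 'I_n.+1 * 'I_n.+1 * 'I_L.+2) (k : nat) : R :=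
  if k == a.1.1 :> nat then r a.2 else if k == a.1.2 :> nat then - (1 - r a.2) else 0.
have [x [x1 x2 x3]] := euclidean_selection gP c Xinf C0 HC S0 e'01.
have xA i : (i < n.+1)%N -> `|x i| <= A.
  move=> /x2 H; rewrite -[leLHS](ger0_norm (normr_ge0 _)) -sqrtr_sqr.
  exact: ler_wsqrtr.
exists x; split.
- apply: (le_trans x1); rewrite lee_fin ler_wpM2r ?(ltW S0)// /e'; lra.
- move=> i ilt; have := x3 (Ordinal ilt, Ordinal ilt, ord_max).
  have r1 : r ord_max = 1 by rewrite /r /= divff.
  rewrite (bigD1 (Ordinal ilt))//= big1 ?addr0; last first.
    by move=> k; rewrite -val_eqE/= /c/= => /negbTE->; rewrite expr0n.
  rewrite (bigD1 (Ordinal ilt))//= big1 ?addr0; last first.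
    by move=> k; rewrite -val_eqE/= /c/= => /negbTE->; rewrite scale0r.
  rewrite /c /= eqxx r1 expr1n sqrtr1 mulr1 scale1r; apply: le_trans.
  by rewrite /e'; lra.
- move=> i j ilt jlt ij p q p0 q0.
  have [pq0|pq] := leP (p + q) 0.
    have -> : p + q = 0 by apply/eqP; rewrite eq_le pq0 addr_ge0.
    by rewrite mulr0 normr_ge0.
  pose th := p / (p + q).
  have th01 : 0 <= th <= 1 by rewrite /th divr_ge0 ?(ltW pq)//= ler_pdivrMr// mul1r lerDl.
  have [l Hl] := grid_point L th01; rewrite -/(r l) in Hl.
  have := x3 (Ordinal ilt, Ordinal jlt, l).
  rewrite (bigD1 (Ordinal ilt))//= (bigD1 (Ordinal jlt))/=; last first.
    by rewrite -val_eqE/= eq_sym.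
  rewrite big1 ?addr0; last first.
    by move=> k; rewrite -!val_eqE/= /c/= => /andP[/negbTE-> /negbTE->]; rewrite expr0n.
  rewrite (bigD1 (Ordinal ilt))//= (bigD1 (Ordinal jlt))/=; last first.
    by rewrite -val_eqE/= eq_sym.
  rewrite big1 ?addr0; last first.
    by move=> k; rewrite -!val_eqE/= /c/= => /andP[/negbTE-> /negbTE->]; rewrite scale0r.
  rewrite /c /= eqxx eq_sym (negbTE ij) eqxx sqrrN scaleNr => Hr.
  have half : (Num.sqrt 2)^-1 <= Num.sqrt (r l ^+ 2 + (1 - r l) ^+ 2).
    rewrite -sqrtrV// ler_wsqrtr//; have := sqr_ge0 (r l - 2^-1); lra.
  have -> : p *: x i - q *: x j = (p + q) *: (th *: x i - (1 - th) *: x j).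
    rewrite scalerBr !scalerA; congr (_ *: _ - _ *: _).
      by rewrite /th mulrCA divff ?mulr1// gt_eqF.
    by rewrite /th; field; rewrite gt_eqF.
  rewrite normrZ (gtr0_norm pq) mulrC ler_pM2l//.
  have : `|r l *: x i - (1 - r l) *: x j| <= `|th *: x i - (1 - th) *: x j| +
      `|th - r l| * (`|x i| + `|x j|).
    have -> : r l *: x i - (1 - r l) *: x j = (th *: x i - (1 - th) *: x j) -
        ((th - r l) *: x i + (th - r l) *: x j).
      rewrite opprD addrACA -scalerBl -opprD -scalerDl.
      by congr (_ *: _ - _ *: _); ring.
    apply: (le_trans (ler_normB _ _)); rewrite lerD2l.
    by apply: (le_trans (ler_normD _ _)); rewrite !normrZ mulrDr.
  move=> tri.
  have eL : L.+1%:R^-1 * (A + A) <= e / 2 * (Num.sqrt 2)^-1.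
    rewrite ler_pdivrMl// mulrC -ler_pdivrMl ?divr_gt0// mulrC.
    apply: le_trans Lb; rewrite le_eqVlt; apply/orP; left; apply/eqP; field.
    by rewrite !gt_eqF.
  have small : `|th - r l| * (`|x i| + `|x j|) <= e / 2 * (Num.sqrt 2)^-1.
    by apply: le_trans eL; apply: ler_pM => //; rewrite ?addr_ge0// lerD// xA.
  have big : (1 - e') * (Num.sqrt 2)^-1 <= `|r l *: x i - (1 - r l) *: x j|.
    by apply: le_trans Hr; rewrite ler_wpM2l// /e'; lra.
  rewrite mulrBl mul1r; rewrite /e' mulrBl mul1r in big.
  lra.
Qed.

End SeparatedSystem.

(** * Lipschitz maps *)

Section Lipschitz.
Variables (R : realType) (X Y : normedModType R).
Implicit Types (f : X -> Y) (L : R).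

Lemma klipschitzP L f :
  L.-lipschitz f <-> forall x y, `|f x - f y| <= L * `|x - y|.
Proof.
split=> [H x y|H [x y] _]; last exact: H.
exact: (H (x, y)).
Qed.

Lemma lipschitz_Lip0 L f : f 0 = 0 -> L.-lipschitz f -> Lip0 f.
Proof.
move=> f0 fL; split=> //; apply: klipschitzW fL.
exact: (@globally_properfilter _ _ (0, 0)).
Qed.

Let bounds f := [set L : R | 0 <= L /\ L.-lipschitz f].

Let bounds_lb f : has_lbound (bounds f).
Proof. by exists 0 => L []. Qed.

Lemma lipnorm_le L f : 0 <= L -> L.-lipschitz f -> lipnorm f <= L.
Proof. by move=> L0 fL; apply: (ge_inf (bounds_lb f)). Qed.

Lemma lipnorm_ge0 f : 0 <= lipnorm f.
Proof.
(* Without any Lipschitz constant the infimum is over the empty set, where it is 0 by default. *)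
have [B0|B0] := pselect (bounds f !=set0).
  by apply: lb_le_inf => // L [].
have -> : lipnorm f = 0; last by [].
rewrite /lipnorm -[X in inf X]/(bounds f); suff -> : bounds f = set0 by rewrite inf0.
by apply: contrapT => /eqP/set0P.
Qed.

Lemma lipnormP f x y : Lip0 f -> `|f x - f y| <= lipnorm f * `|x - y|.
Proof.
move=> [_ [M [_ HM]]].
have [->|xy] := eqVneq x y; first by rewrite !subrr !normr0 mulr0.
have xy0 : 0 < `|x - y| by rewrite normr_gt0 subr_eq0.
rewrite -ler_pdivrMr//; apply: lb_le_inf => [|L [L0 /klipschitzP fL]].
  exists (Num.max 0 (M + 1)); split; first by rewrite le_max lexx.
  apply: HM => //; rewrite lt_max; apply/orP; right; by rewrite ltrDl.
by rewrite ler_pdivrMr.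
Qed.

Lemma lipnorm_le_norm f x : Lip0 f -> `|f x| <= lipnorm f * `|x|.
Proof. by move=> Lf; have := lipnormP x 0 Lf; rewrite Lf.1 !subr0. Qed.

(* The interpolating map is a sum of cones with disjoint supports. *)
Lemma lipschitz_interpolation L n (p : 'I_n -> X) (r : 'I_n -> R) (z : 'I_n -> Y) :
    0 <= L -> (forall i, 0 <= r i) -> (forall i, r i <= `|p i|) ->
    (forall i j, i != j -> r i + r j <= `|p i - p j|) -> (forall i, `|z i| <= L) ->
  exists f, [/\ f 0 = 0, L.-lipschitz f & forall i, f (p i) = r i *: z i].
Proof.
move=> L0 r0 rp rpp zL.
pose phi i x : R := Num.max 0 (r i - `|x - p i|).
have phi0 i x : 0 <= phi i x by rewrite le_max lexx.
have phi_pos i x : 0 < phi i x -> phi i x = r i - `|x - p i|.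
  by rewrite lt_max ltxx => /ltW /max_idPr.
have phi_lip i x y : phi i x - phi i y <= `|x - y|.
  have : `|y - p i| <= `|x - y| + `|x - p i|.
    by rewrite -(normrN (x - y)) opprB -[in leLHS](subrKA x) ler_normD.
  have phi_ge : r i - `|y - p i| <= phi i y by rewrite le_max lexx orbT.
  have := normr_ge0 (x - y); have := phi0 i y.
  rewrite lerBlDr {2}/phi ge_max => *; apply/andP; split; lra.
(* Heights in two different cones add up to at most the distance, so the sum keeps the constant [L]
   of one cone instead of doubling it. *)
have phi_sep i j x y : i != j -> 0 < phi i x -> 0 < phi j y ->
    phi i x + phi j y <= `|x - y|.
  move=> /rpp ij /phi_pos-> /phi_pos->.
  have : `|p i - p j| <= `|x - p i| + (`|x - y| + `|y - p j|).
    rewrite -(normrN (x - p i)) opprB -[in leLHS](subrKA x).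
    apply: (le_trans (ler_normD _ _)); rewrite lerD2l.
    by rewrite -[in leLHS](subrKA y) ler_normD.
  lra.
pose f x := \sum_i phi i x *: z i.
have fE i x : 0 < phi i x -> f x = phi i x *: z i.
  move=> ix; rewrite /f (bigD1 i)//= big1 ?addr0// => j ji.
  have [->|jx] := eqVneq (phi j x) 0; first by rewrite scale0r.
  have jx0 : 0 < phi j x by rewrite lt_neqAle eq_sym jx phi0.
  by exfalso; have := phi_sep _ _ _ _ ji jx0 ix; rewrite subrr normr0; lra.
have f_cases x : (forall i, phi i x = 0) \/ exists i, 0 < phi i x.
  have [[i ix]|nex] := pselect (exists i, 0 < phi i x); first by right; exists i.
  left=> i; apply/eqP; rewrite eq_le phi0 andbT leNgt; apply/negP => ix.
  by apply: nex; exists i.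
have f_eq0 x : (forall i, phi i x = 0) -> f x = 0.
  by move=> x0; rewrite /f big1// => i _; rewrite x0 scale0r.
have half x y i : 0 < phi i x -> phi i y = 0 -> `|phi i x *: z i| <= L * `|x - y|.
  move=> ix iy; rewrite normrZ gtr0_norm// mulrC; apply: ler_pM; rewrite ?(ltW ix)//.
  by have := phi_lip i x y; rewrite iy subr0.
have flip x y : `|f x - f y| <= L * `|x - y|.
  have [x0|[i ix]] := f_cases x; have [y0|[j jy]] := f_cases y.
  - by rewrite !f_eq0// subrr normr0 mulr_ge0.
  - by rewrite (f_eq0 x)// (fE j)// sub0r normrN distrC half.
  - by rewrite (f_eq0 y)// (fE i)// subr0 half.
  - rewrite (fE i)// (fE j)//.
    have [ij|ij] := eqVneq i j.
      rewrite -ij in jy *; rewrite -scalerBl normrZ mulrC ler_pM//.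
      by rewrite ler_norml phi_lip andbT lerNl opprB distrC phi_lip.
    apply: (le_trans (ler_normB _ _)); rewrite !normrZ !gtr0_norm//.
    have := phi_sep _ _ _ _ ij ix jy; have := zL i; have := zL j; nra.
exists f; split; last 2 first.
- exact/klipschitzP.
- move=> i; have phii : phi i (p i) = r i.
    by rewrite /phi subrr normr0 subr0; exact/max_idPr.
  have [ri|] := eqVneq (r i) 0.
    rewrite ri scale0r; apply: f_eq0 => j.
    have [->|ji] := eqVneq j i; first by rewrite phii.
    rewrite /phi distrC; apply/max_idPl; have := rpp _ _ ji; rewrite ri addr0 distrC; lra.
  by move=> ri; rewrite (fE i) phii// lt_neqAle eq_sym ri r0.
- by apply: f_eq0 => i; rewrite /phi sub0r normrN; apply/max_idPl; have := rp i; lra.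
Qed.

End Lipschitz.

(** * Type and cotype *)

Section RandomSums.
Variables (R : realType) (d : measure_display) (T : measurableType d).
Variables (P : probability T R) (g : nat -> {RV P >-> R}).
Hypothesis gP : standard_gaussian_sequence g.
Implicit Type X : normedModType R.

Definition gauss_norm_sqr X n (x : 'I_n -> X) : R :=
  fine (\int[P]_w (`|\sum_(j < n) g j w *: x j| ^+ 2)%:E)%E.

Lemma integral_gauss_norm_sqr X n (x : 'I_n -> X) :
  (\int[P]_w (`|\sum_(j < n) g j w *: x j| ^+ 2)%:E = (gauss_norm_sqr x)%:E)%E.
Proof.
rewrite fineK// ge0_fin_numE.
  exact: (gaussian_vector_sqr_lty (standard_gaussian_sequenceP gP) x 0).
by apply: integral_ge0 => w _; rewrite lee_fin sqr_ge0.
Qed.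

Lemma gauss_norm_sqr_ge0 X n (x : 'I_n -> X) : 0 <= gauss_norm_sqr x.
Proof.
rewrite -lee_fin -integral_gauss_norm_sqr.
by apply: integral_ge0 => w _; rewrite lee_fin sqr_ge0.
Qed.

Lemma gauss_normE X n (x : 'I_n -> X) :
  gauss_norm g x = (Num.sqrt (gauss_norm_sqr x))%:E.
Proof.
rewrite /gauss_norm unlock integral_gauss_norm_sqr poweR_EFin powR12_sqrt//.
exact: gauss_norm_sqr_ge0.
Qed.

Lemma gauss_norm_sqr_line X n (c : 'I_n -> R) (x : X) : `|x| = 1 ->
  gauss_norm_sqr (fun j => c j *: x) = \sum_(j < n) c j ^+ 2.
Proof.
move=> x1; apply: EFin_inj; rewrite -integral_gauss_norm_sqr.
rewrite -(gaussian_second_moment_ord (standard_gaussian_sequenceP gP)).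
apply: eq_integral => w _; under eq_bigr do rewrite scalerA mulrC.
by rewrite -scaler_suml normrZ x1 mulr1 real_normK ?num_real.
Qed.

Lemma l2_norm_ge0 X n (x : 'I_n -> X) : 0 <= l2_norm x.
Proof. exact: sqrtr_ge0. Qed.

Lemma l2_norm_sqr X n (x : 'I_n -> X) : l2_norm x ^+ 2 = \sum_(j < n) `|x j| ^+ 2.
Proof. by rewrite sqr_sqrtr// sumr_ge0// => i _; exact: sqr_ge0. Qed.

Section LipschitzBounds.
Variables (X Y : normedModType R).
Hypotheses (dimX : infinite_dim X) (dimY : dim_ge Y 1).

Lemma type_cotype_separate (C T2 : R) : 0 <= C -> 0 <= T2 ->
  cotype2_with g X C%:E -> type2_with g Y T2%:E -> separate_lip_bound g X Y (T2 * C).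
Proof.
move=> C0 T20 HC HT n x a f a0 Lf.
set L := \big[Num.max/0]_(j < n) lipnorm (f j).
have L0 : 0 <= L by exact: bigmax_ge_id.
apply: (le_trans (HT _ _)); rewrite gauss_normE -!EFinM lee_fin.
have := HC n x; rewrite gauss_normE -EFinM lee_fin => HCx.
rewrite -!mulrA ler_wpM2l// (mulrCA C).
apply: (@le_trans _ _ (L * l2_norm x)); last by rewrite ler_wpM2l.
rewrite -[leRHS]ger0_norm ?mulr_ge0 ?l2_norm_ge0// -sqrtr_sqr ler_wsqrtr//.
rewrite exprMn l2_norm_sqr mulr_sumr; apply: ler_sum => j _.
rewrite -exprMn ler_pXn2r ?nnegrE ?mulr_ge0//.
rewrite normrZ gtr0_norm ?invr_gt0// ler_pdivrMl//.
apply: (le_trans (lipnorm_le_norm _ (Lf j))).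
rewrite normrZ (gtr0_norm (a0 j)) mulrCA ler_wpM2l ?(ltW (a0 j))//.
by rewrite ler_wpM2r//; apply: le_bigmax.
Qed.

Lemma separate_common (K : R) :
  separate_lip_bound g X Y K -> common_lip_bound g X Y K.
Proof.
move=> H n x; exists (fun=> 1) => // f Lf.
have := H n x (fun=> 1) (fun=> f) (fun=> ltr01) (fun=> Lf).
(* For the empty family the maximum is 0 and not [lipnorm f], but there both Gaussian sums
   vanish. *)
case: n x => [|n] x; last first.
  rewrite (_ : \big[Num.max/0]_(j < n.+1) lipnorm f = lipnorm f)//.
  apply/eqP; rewrite eq_le; apply/andP; split; last exact: (le_bigmax _ _ ord0).
  by apply: bigmax_le => //; exact: lipnorm_ge0.
move=> _; rewrite !gauss_normE.
have S0 (Z : normedModType R) (z : 'I_0 -> Z) : gauss_norm_sqr z = 0.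
  apply: EFin_inj; rewrite -integral_gauss_norm_sqr.
  by under eq_integral do rewrite big_ord0 normr0 expr0n; rewrite integral0.
by rewrite !S0 sqrtr0 mule0.
Qed.

Lemma exists_unit_vector (Z : normedModType R) : dim_ge Z 1 -> exists z : Z, `|z| = 1.
Proof.
move=> [e He]; have e0 : e ord0 != 0.
  apply/eqP => e0; have := He (fun=> 1); rewrite big_ord1 scale1r => /(_ e0 ord0)/eqP.
  by rewrite oner_eq0.
exists (`|e ord0|^-1 *: e ord0).
by rewrite normrZ normfV normr_id mulVf// normr_eq0.
Qed.

Variable K : R.
Hypothesis HK : common_lip_bound g X Y K.

Let HKR n (x : 'I_n -> X) : exists2 a : 'I_n -> R, (forall j, 0 < a j) &
  forall f : X -> Y, Lip0 f ->
    Num.sqrt (gauss_norm_sqr (fun j => (a j)^-1 *: f (a j *: x j))) <=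
    K * lipnorm f * Num.sqrt (gauss_norm_sqr x).
Proof.
have [a a0 Ha] := HK x; exists a => // f /Ha.
by rewrite !gauss_normE -EFinM lee_fin.
Qed.

(** A positively homogeneous [f] cancels the unknown scalars. Its Lipschitz norm [L] is kept because
    replacing it by 1 requires [K >= 0], which is deduced from this very bound. *)
Let norm_bound : exists2 L, 0 <= L <= 1 &
  forall n (x : 'I_n -> X), l2_norm x <= K * L * Num.sqrt (gauss_norm_sqr x).
Proof.
have [y0 y01] := exists_unit_vector dimY.
pose f (x : X) := `|x| *: y0.
have fL : 1.-lipschitz f.
  apply/klipschitzP => x y; rewrite /f -scalerBl normrZ y01 mulr1 mul1r.
  exact: ler_dist_dist.
have Lf : Lip0 f by apply: lipschitz_Lip0 fL; rewrite /f normr0 scale0r.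
exists (lipnorm f); first by rewrite lipnorm_ge0 lipnorm_le.
move=> n x; have [a a0 /(_ f Lf)] := HKR x; apply: le_trans.
rewrite (_ : (fun j => _) = (fun j => `|x j| *: y0)) ?gauss_norm_sqr_line//.
apply/funext => j; rewrite /f normrZ (gtr0_norm (a0 j)) scalerA mulKf//.
by rewrite gt_eqF.
Qed.

Lemma common_lip_bound_gt0 : 0 < K.
Proof.
have [x x1] := exists_unit_vector (dimX 1).
have [L /andP[L0 _] /(_ 1%N (fun=> x))] := norm_bound.
rewrite /l2_norm big_ord1 x1 expr1n sqrtr1 ltNge => H.
apply/negP => K0.
have : K * L * Num.sqrt (gauss_norm_sqr (fun _ : 'I_1 => x)) <= 0.
  by rewrite mulr_le0_ge0 ?sqrtr_ge0// mulr_le0_ge0.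
by move=> /(le_trans H); rewrite ler10.
Qed.

Let cotypeR n (x : 'I_n -> X) : l2_norm x <= K * Num.sqrt (gauss_norm_sqr x).
Proof.
have [L /andP[L0 L1] /(_ n x)] := norm_bound; move=> /le_trans; apply.
rewrite ler_wpM2r ?sqrtr_ge0// -[leRHS]mulr1 ler_wpM2l// ltW//.
exact: common_lip_bound_gt0.
Qed.

Lemma common_cotype2 : cotype2_with g X K%:E.
Proof. by move=> n x; rewrite gauss_normE -EFinM lee_fin cotypeR. Qed.

Let typeR_eps n (y : 'I_n.+1 -> Y) (e : R) : 0 < e < 1 ->
  0 < \sum_(j < n.+1) `|y j| ^+ 2 ->
  (1 - e) * Num.sqrt (gauss_norm_sqr y) <= (1 + e) * (Num.sqrt 2 * K * l2_norm y).
Proof.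
move=> e01 S0; have /andP[e0 e1] := e01; have K0 := common_lip_bound_gt0.
pose t (i : nat) : R := if insub i is Some j then `|y j| else 0.
have tE (i : 'I_n.+1) : t i = `|y i| by rewrite /t valK.
have sumt : \sum_(i < n.+1) t i ^+ 2 = \sum_(j < n.+1) `|y j| ^+ 2.
  by apply: eq_bigr => i _; rewrite tE.
have [||x [x1 x2 x3]] :=
    separated_system (standard_gaussian_sequenceP gP) (n := n) (t := t) (C := K) dimX K0 _ _ e01.
- move=> m z; rewrite (integral_gauss_norm_sqr z) -EFinM lee_fin.
  rewrite -l2_norm_sqr -(sqr_sqrtr (gauss_norm_sqr_ge0 z)) -exprMn.
  by rewrite ler_pXn2r ?nnegrE ?mulr_ge0 ?l2_norm_ge0 ?sqrtr_ge0 ?(ltW K0)//.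
- by rewrite sumt.
rewrite sumt in x1; rewrite (integral_gauss_norm_sqr (fun i : 'I_n.+1 => t i *: x i)) lee_fin in x1.
(* The scalars appear after the vectors; the separation of [x] will be used with [p] and [q] equal
   to the products [a i * t i]. *)
have [a a0 Ha] := HKR (fun i : 'I_n.+1 => t i *: x i).
have s20 : 0 < Num.sqrt 2 :> R by rewrite sqrtr_gt0.
pose th := (1 - e) / Num.sqrt 2; have th0 : 0 < th by rewrite divr_gt0// subr_gt0.
pose s (i : 'I_n.+1) := a i * t i.
have s0 i : 0 <= s i by rewrite mulr_ge0 ?(ltW (a0 i))// tE.
(* Radius times slope vector is [a i *: y i] at the center, and the slopes have norm at most
   [th^-1]. If [y i = 0] the inverse is 0 by convention and both sides vanish. *)
have [|||||f [f0 fL fp]] := @lipschitz_interpolation _ X Y th^-1 n.+1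
    (fun i => a i *: (t i *: x i)) (fun i => th * s i)
    (fun i => (th * `|y i|)^-1 *: y i).
- by rewrite invr_ge0 ltW.
- by move=> i; rewrite mulr_ge0// ltW.
- move=> i; rewrite scalerA normrZ ger0_norm ?s0// mulrC ler_wpM2l ?s0//.
  apply: le_trans (x2 _ (ltn_ord i)); rewrite /th -[leRHS]mulr1 ler_wpM2l//.
    by rewrite subr_ge0 ltW.
  by rewrite invf_le1// -[leLHS]sqrtr1 ler_wsqrtr// ler1n.
- by move=> i j ij; rewrite -mulrDr !scalerA; apply: x3.
- move=> i; rewrite normrZ normfV normrM normr_id (gtr0_norm th0) invfM -mulrA.
  have [->|yi] := eqVneq `|y i| 0; first by rewrite mulr0 mulr0 invr_ge0 ltW.
  by rewrite mulVf// mulr1.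
have Lf := lipschitz_Lip0 f0 fL.
have lf : lipnorm f <= th^-1 by apply: lipnorm_le => //; rewrite invr_ge0 ltW.
have := Ha f Lf; rewrite (_ : (fun j => _) = y); last first.
  apply/funext => i; rewrite fp /s tE !scalerA.
  have [->|yi] := eqVneq (y i) 0; first by rewrite scaler0.
  rewrite (_ : _ * _ = 1) ?scale1r//; field.
  by rewrite normr_eq0 yi !gt_eqF.
move=> H; have {}H : Num.sqrt (gauss_norm_sqr y) <= K * th^-1 * ((1 + e) * l2_norm y).
  apply: (le_trans H); apply: ler_pM; rewrite ?sqrtr_ge0 ?mulr_ge0 ?lipnorm_ge0 ?(ltW K0)//.
    by rewrite ler_wpM2l// ltW.
  apply: (le_trans (ler_wsqrtr x1)); rewrite sqrtrM; last by lra.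
  rewrite ler_wpM2r ?sqrtr_ge0//.
  rewrite -[leRHS](ger0_norm (_ : 0 <= 1 + e)); last by lra.
  by rewrite -sqrtr_sqr ler_wsqrtr//; nra.
have -> : (1 + e) * (Num.sqrt 2 * K * l2_norm y) =
    (1 - e) * (K * th^-1 * ((1 + e) * l2_norm y)).
  by rewrite /th; field; rewrite !gt_eqF// subr_gt0.
by rewrite ler_wpM2l// subr_ge0 ltW.
Qed.

Lemma common_type2 : type2_with g Y (Num.sqrt 2 * K)%:E.
Proof.
move=> n y; rewrite gauss_normE -EFinM lee_fin.
have B0 : 0 <= Num.sqrt 2 * K * l2_norm y.
  by rewrite !mulr_ge0 ?sqrtr_ge0 ?l2_norm_ge0// ltW// common_lip_bound_gt0.
have S0 : 0 <= \sum_(j < n) `|y j| ^+ 2 by apply: sumr_ge0 => j _; exact: sqr_ge0.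
have [Sz|Spos] := eqVneq (\sum_(j < n) `|y j| ^+ 2) 0.
  rewrite (_ : gauss_norm_sqr y = 0) ?sqrtr0//.
  apply: EFin_inj; rewrite -integral_gauss_norm_sqr.
  rewrite -[RHS](integral0 P setT); apply: eq_integral => w _.
  rewrite big1 ?normr0 ?expr0n// => j _; move/eqP: Sz.
  rewrite psumr_eq0 => [|i _]; last exact: sqr_ge0.
  by move=> /allP/(_ j (mem_index_enum _)); rewrite /= sqrf_eq0 normr_eq0 => /eqP->; rewrite scaler0.
case: n y B0 S0 Spos => [|n] y B0 S0 Spos; first by rewrite big_ord0 eqxx in Spos.
have {}Spos : 0 < \sum_(j < n.+1) `|y j| ^+ 2 by rewrite lt_neqAle eq_sym Spos.
have G0 := sqrtr_ge0 (gauss_norm_sqr y).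
rewrite leNgt; apply/negP => BG.
set B := _ * l2_norm y in B0 BG; set G := Num.sqrt _ in G0 BG.
(* The approximate bound [(1 - e) * G <= (1 + e) * B] means [G - B <= e * (G + B)]; this [e] makes
   the right side half of [G - B], which is positive. *)
pose e := (G - B) / (2 * (G + B)).
have GB : 0 < 2 * (G + B) by lra.
have e0 : 0 < e by rewrite divr_gt0// subr_gt0.
have e1 : e < 1 by rewrite ltr_pdivrMr//; lra.
have eE : e * (G + B) = (G - B) / 2 by rewrite /e; field; rewrite gt_eqF//; lra.
have := typeR_eps (y := y) (e := e) (introT andP (conj e0 e1)) Spos.
rewrite -/B -/G; lra.
Qed.

End LipschitzBounds.

End RandomSums.

Theorem theorem1 (R : realType) (X Y : completeNormedModType R)
  (dimX : infinite_dim X) (dimY : dim_ge Y 1)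
  (d : measure_display) (Omega : measurableType d) (P : probability Omega R)
  (gamma : nat -> {RV P >-> R}) (hgamma : standard_gaussian_sequence gamma) :
  [/\ (exists K : R, separate_lip_bound gamma X Y K) <->
      (exists K : R, common_lip_bound gamma X Y K),
      (exists K : R, common_lip_bound gamma X Y K) <->
      (has_cotype2 gamma X /\ has_type2 gamma Y) &
      forall K : R,
        separate_lip_bound gamma X Y K \/ common_lip_bound gamma X Y K ->
        (cotype2_const gamma X <= K%:E)%E /\
        (type2_const gamma Y <= (Num.sqrt 2 * K)%R%:E)%E].
Proof.
have common_tc K : common_lip_bound gamma X Y K -> [/\ 0 <= K,
    cotype2_with gamma X K%:E & type2_with gamma Y (Num.sqrt 2 * K)%:E].
  move=> HK; split.
  - exact/ltW/(common_lip_bound_gt0 hgamma dimX dimY HK).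
  - exact: (common_cotype2 hgamma dimX dimY HK).
  - exact: (common_type2 hgamma dimX dimY HK).
have tc_separate : has_cotype2 gamma X /\ has_type2 gamma Y ->
    exists K : R, separate_lip_bound gamma X Y K.
  move=> [[C [C0 HC]] [T2 [T20 HT]]]; exists (T2 * C).
  exact: (type_cotype_separate hgamma).
have common_has : (exists K : R, common_lip_bound gamma X Y K) ->
    has_cotype2 gamma X /\ has_type2 gamma Y.
  move=> [K /common_tc[K0 HC HT]]; split; first by exists K.
  by exists (Num.sqrt 2 * K); rewrite mulr_ge0 ?sqrtr_ge0.
split.
- split; last by move=> /common_has/tc_separate.
  by move=> [K HK]; exists K; exact: (separate_common hgamma).
- split=> // /tc_separate[K HK]; exists K; exact: (separate_common hgamma).
- move=> K HK; have {}HK : common_lip_bound gamma X Y K.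
    by case: HK => // HK; exact: (separate_common hgamma).
  have [K0 HC HT] := common_tc K HK; split; apply: ereal_inf_lbound; split=> //.
  by rewrite lee_fin mulr_ge0 ?sqrtr_ge0.
Qed.
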